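(* Let $s\in\{2,3,\ldots,\infty\}$. Then $H_n^{(s)}$ is an easy quantum group, and its associated category $E_h^s$ is that of the ''$s$-balanced'' partitions, i.e. the partitions satisfying the following conditions: (1) The total number of legs is even. (2) In each block, the number of odd legs equals the number of even legs, modulo $s$.
   Context: $C(H_n^{(s)})$ is the universal $C^*$-algebra generated by $n^2$ self-adjoint variables $u_{ij}$ subject to: (i) $uu^t=u^tu=1$, where $u=(u_{ij})$, $u^t=(u_{ji})$; (ii) cubic relations $u_{ij}u_{ik}=u_{ji}u_{ki}=0$ for any $i$ and any $j\ne k$; (iii) half-commutation $abc=cba$ for any $a,b,c\in\{u_{ij}\}$; (iv) $s$-mixing $abab\ldots=baba\ldots$ (length $s$ words) for any $a,b\in\{u_{ij}\}$. For $s=\infty$ the relation (iv) disappears. This is a compact quantum group with $\Delta(u_{ij})=\sum_ku_{ik}\otimes u_{kj}$. $P(k,l)$ is the set of partitions of $k$ upper points and $l$ lower points; the legs (points) of a partition are labeled $1,2,3,\ldots$ clockwise starting from top left, and odd/even refers to this labeling. ''Equals modulo $\infty$'' means equality. For $p\in P(k,l)$, $T_p(e_{i_1}\otimes\cdots\otimes e_{i_k})=\sum_{j_1\ldots j_l}\delta_p\binom{i_1\ldots i_k}{j_1\ldots j_l}e_{j_1}\otimes\cdots\otimes e_{j_l}$, where $e_1,\dots,e_n$ is the standard basis of $\mathbb C^n$, and $\delta_p=1$ if all blocks of $p$ contain equal indices and $\delta_p=0$ otherwise. Let $O_n^+$ be the free orthogonal quantum group (relations $u_{ij}=u_{ij}^*$,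 $uu^t=u^tu=1$). A compact quantum group $S_n\subset G\subset O_n^+$ with fundamental representation $u$ is easy, with associated category $(D(k,l))$, if $D(k,l)\subset P(k,l)$ form a category of partitions (closed under horizontal and vertical concatenation and upside-down turning, containing the identity $|$ and the semicircle) and $Hom(u^{\otimes k},u^{\otimes l})=\{T: Tu^{\otimes k}=u^{\otimes l}T\}=span(T_p\mid p\in D(k,l))$ for all $k,l$. *)

(* Defs.v *)
From HB Require Import structures.
From mathcomp Require Import all_boot all_order all_fingroup all_algebra.
From mathcomp Require Import complex reals.

Set Implicit Arguments.
Unset Strict Implicit.
Unset Printing Implicit Defensive.

Import Order.TTheory GRing.Theory Num.Theory.

Local Open Scope complex_scope.
Local Open Scope ring_scope.

(* The norm is an operation of its own, rather than the one of a normed module,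
   because the library has no common superstructure for rings and normed
   modules other than numeric domains. *)
HB.mixin Record isCStarAlgebra (R : realType) A of GRing.Algebra R[i] A := {
  star : A -> A ;
  cnorm : A -> R ;
  starK : involutive star ;
  starD : {morph star : x y / x + y} ;
  starZ : forall (c : R[i]) (x : A), star (c *: x) = Num.conj c *: star x ;
  starM : forall x y : A, star (x * y) = star y * star x ;
  cnorm_eq0 : forall x : A, cnorm x = 0 -> x = 0 ;
  cnormD : forall x y : A, cnorm (x + y) <= cnorm x + cnorm y ;
  cnormZ : forall (c : R[i]) (x : A), (cnorm (c *: x))%:C = `|c| * (cnorm x)%:C ;
  cnormM : forall x y : A, cnorm (x * y) <= cnorm x * cnorm y ;
  cnorm_complete : forall x_ : nat -> A,
    (forall e : R, 0 < e -> exists N, forall p q : nat,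
       (N <= p)%N -> (N <= q)%N -> cnorm (x_ p - x_ q) < e) ->
    exists l : A, forall e : R, 0 < e -> exists N, forall p : nat,
       (N <= p)%N -> cnorm (x_ p - l) < e ;
  cstar_identity : forall x : A, cnorm (star x * x) = cnorm x ^+ 2
}.

(* Unital complex C*-algebras (nonzero, as is the case of every [algType]). *)
#[short(type="cstarAlgType")]
HB.structure Definition CStarAlgebra (R : realType) :=
  {A of isCStarAlgebra R A & GRing.Algebra R[i] A}.

Definition cstar_closure (R : realType) (A : cstarAlgType R) (S : A -> Prop) :
    A -> Prop :=
  fun x => forall e : R, 0 < e -> exists2 y : A, S y & cnorm (x - y) < e.

Record starHom (R : realType) (A B : cstarAlgType R) := StarHom {
  starhom_fun :> {lrmorphism A -> B} ;
  starhom_star : forall x : A, starhom_fun (star x) = star (starhom_fun x)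
}.

Definition cstar_generated (R : realType) (n : nat)
    (A : cstarAlgType R) (u : 'M[A]_n) : Prop :=
  forall S : A -> Prop,
    S 1 ->
    (forall (c : R[i]) (x y : A), S x -> S y -> S (c *: x + y)) ->
    (forall x y : A, S x -> S y -> S (x * y)) ->
    (forall x : A, S x -> S (star x)) ->
    (forall x : A, cstar_closure S x -> S x) ->
    (forall i j : 'I_n, S (u i j)) ->
    forall x : A, S x.

(* [A] is the universal C*-algebra generated by the entries of [u] subject to
   the relations [rel]. Generation makes the morphism to [B] unique. *)
Definition universal_cstar (R : realType) (n : nat)
    (rel : forall B : cstarAlgType R, 'M[B]_n -> Prop)
    (A : cstarAlgType R) (u : 'M[A]_n) : Prop :=
  [/\ rel A u,
      cstar_generated u &
      forall (B : cstarAlgType R) (v : 'M[B]_n), rel B v ->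
        exists f : starHom A B, forall i j : 'I_n, f (u i j) = v i j].

Definition free_orthogonal_rel (R : realType) (n : nat)
    (B : cstarAlgType R) (u : 'M[B]_n) : Prop :=
  [/\ forall i j : 'I_n, star (u i j) = u i j,
      u *m u^T = 1%:M &
      u^T *m u = 1%:M].

(* The word [a b a b ...] of length [m]. *)
Fixpoint alternating (T : nzRingType) (m : nat) (a b : T) : T :=
  if m is m'.+1 then a * alternating m' b a else 1.

(* The defining relations of C(H_n^(s)); [s = None] stands for s = infinity. *)
Definition hyperoctahedral_series_rel (R : realType) (n : nat) (s : option nat)
    (B : cstarAlgType R) (u : 'M[B]_n) : Prop :=
  [/\ free_orthogonal_rel u,
      forall i j k : 'I_n, j != k -> u i j * u i k = 0 /\ u j i * u k i = 0,
      forall i1 j1 i2 j2 i3 j3 : 'I_n,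
        u i1 j1 * u i2 j2 * u i3 j3 = u i3 j3 * u i2 j2 * u i1 j1 &
      if s is Some m then
        forall i1 j1 i2 j2 : 'I_n,
          alternating m (u i1 j1) (u i2 j2) = alternating m (u i2 j2) (u i1 j1)
      else True].

(* The image of the elementary sum of tensors [\sum_t a t (x) b t]. *)
Definition tensor_sum (R : realType) (A B T : cstarAlgType R)
    (f : starHom A T) (g : starHom B T) (m : nat)
    (a : 'I_m -> A) (b : 'I_m -> B) : T :=
  \sum_(t < m) f (a t) * g (b t).

(* [T], with [f a = a (x) 1] and [g b = 1 (x) b], is a completion of the
   algebraic tensor product of [A] and [B] for some C*-norm. The second clause
   says that the algebraic tensor product embeds in [T]. *)
Definition cstar_tensor_product (R : realType) (A B T : cstarAlgType R)
    (f : starHom A T) (g : starHom B T) : Prop :=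
  [/\ forall (a : A) (b : B), f a * g b = g b * f a,
      forall (m : nat) (a : 'I_m -> A) (b : 'I_m -> B),
        (forall c : 'I_m -> R[i],
           \sum_(t < m) c t *: a t = 0 -> forall t, c t = 0) ->
        tensor_sum f g a b = 0 -> forall t, b t = 0 &
      forall x : T,
        cstar_closure (fun y => exists (m : nat) (a : 'I_m -> A) (b : 'I_m -> B),
                         y = tensor_sum f g a b) x].

(* The minimal (spatial) C*-tensor product. *)
Definition min_tensor_product (R : realType) (A B T : cstarAlgType R)
    (f : starHom A T) (g : starHom B T) : Prop :=
  cstar_tensor_product f g /\
  forall (T' : cstarAlgType R) (f' : starHom A T') (g' : starHom B T'),
    cstar_tensor_product f' g' ->
    forall (m : nat) (a : 'I_m -> A) (b : 'I_m -> B),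
      cnorm (tensor_sum f g a b) <= cnorm (tensor_sum f' g' a b).

(* Woronowicz's compact matrix quantum groups: [A = C(G)] with fundamental
   representation [u]. *)
Definition compact_matrix_quantum_group (R : realType) (n : nat)
    (A : cstarAlgType R) (u : 'M[A]_n) : Prop :=
  [/\ cstar_generated u,
      exists v : 'M[A]_n, u *m v = 1%:M /\ v *m u = 1%:M,
      exists v : 'M[A]_n,
        map_mx star u *m v = 1%:M /\ v *m map_mx star u = 1%:M &
      forall (T : cstarAlgType R) (f g : starHom A T),
        min_tensor_product f g ->
        exists Delta : starHom A T,
          forall i j : 'I_n, Delta (u i j) = \sum_(k < n) f (u i k) * g (u k j)].

(* The inclusion [S_n < G]: a morphism [C(G) -> C(S_n)] sending [u i j] to the
   characteristic function of the permutations mapping [j] to [i]. As [C(S_n)]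
   is the algebra of all functions on ['S_n], with pointwise operations, such a
   morphism is a family of unital *-characters, indexed by ['S_n]. *)
Definition contains_symmetric_group (R : realType) (n : nat)
    (A : cstarAlgType R) (u : 'M[A]_n) : Prop :=
  exists ev : 'S_n -> {lrmorphism A -> R[i]^o},
    (forall (sigma : 'S_n) (x : A), ev sigma (star x) = Num.conj (ev sigma x)) /\
    (forall (sigma : 'S_n) (i j : 'I_n),
       ev sigma (u i j) = (i == sigma j)%:R).

(* The inclusion [G < O_n^+]: the entries of [u] satisfy the relations of O_n^+,
   and there is a morphism [C(O_n^+) -> C(G)] sending generators to generators
   (automatically surjective when the entries of [u] generate [C(G)]). *)
Definition contained_in_free_orthogonal (R : realType) (n : nat)
    (A : cstarAlgType R) (u : 'M[A]_n) : Prop :=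
  free_orthogonal_rel u /\
  forall (B : cstarAlgType R) (v : 'M[B]_n),
    universal_cstar (@free_orthogonal_rel R n) v ->
    exists f : starHom B A, forall i j : 'I_n, f (v i j) = u i j.

(* Partitions of [k] upper points [inl a] and [l] lower points [inr b], both
   rows being numbered from left to right, starting from 0. *)
Definition leg (k l : nat) : finType := ('I_k + 'I_l)%type.

Definition parts (k l : nat) : {set {set {set leg k l}}} :=
  [set p | partition p [set: leg k l]].

(* Labels 1, 2, 3, ... run clockwise from the top left, hence from right to
   left on the lower row. *)
Definition leg_label (k l : nat) (x : leg k l) : nat :=
  match x with
  | inl a => a.+1
  | inr b => k + (l - b)
  end%N.

Definition part_hcat (k1 l1 k2 l2 : nat)
    (p : {set {set leg k1 l1}}) (q : {set {set leg k2 l2}}) :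
    {set {set leg (k1 + k2) (l1 + l2)}} :=
  let left_leg (x : leg k1 l1) : leg (k1 + k2) (l1 + l2) :=
    match x with inl a => inl (lshift k2 a) | inr b => inr (lshift l2 b) end in
  let right_leg (x : leg k2 l2) : leg (k1 + k2) (l1 + l2) :=
    match x with inl a => inl (rshift k1 a) | inr b => inr (rshift l1 b) end in
  [set left_leg @: (B : {set _}) | B in p]
    :|: [set right_leg @: (B : {set _}) | B in q].

(* [p] on top of [q]: the blocks are the traces on the outer rows of the
   connected components of the stacked diagram; components contained in the
   middle row disappear. *)
Definition part_vcat (k l m : nat)
    (p : {set {set leg k l}}) (q : {set {set leg l m}}) : {set {set leg k m}} :=
  let top (x : leg k l) : 'I_k + 'I_l + 'I_m := inl x in
  let bot (x : leg l m) : 'I_k + 'I_l + 'I_m :=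
    match x with inl a => inl (inr a) | inr b => inr b end in
  let outer (x : leg k m) : 'I_k + 'I_l + 'I_m :=
    match x with inl a => inl (inl a) | inr b => inr b end in
  let e : rel ('I_k + 'I_l + 'I_m) := fun x y =>
    [exists B in p, (x \in top @: (B : {set _})) && (y \in top @: (B : {set _}))]
    || [exists B in q, (x \in bot @: (B : {set _})) && (y \in bot @: (B : {set _}))] in
  equivalence_partition (fun x y => connect e (outer x) (outer y))
    [set: leg k m].

Definition part_turn (k l : nat) (p : {set {set leg k l}}) : {set {set leg l k}} :=
  let turn (x : leg k l) : leg l k :=
    match x with inl a => inr a | inr b => inl b end in
  [set turn @: (B : {set _}) | B in p].

Definition partition_category
    (D : forall k l : nat, {set {set {set leg k l}}}) : Prop :=
  [/\ forall k l, D k l \subset parts k l,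
      forall k1 l1 k2 l2 p q, p \in D k1 l1 -> q \in D k2 l2 ->
        part_hcat p q \in D (k1 + k2)%N (l1 + l2)%N,
      forall k l m p q, p \in D k l -> q \in D l m ->
        part_vcat p q \in D k m,
      forall k l p, p \in D k l -> part_turn p \in D l k &
      [set [set: leg 1 1]] \in D 1%N 1%N /\ [set [set: leg 0 2]] \in D 0%N 2%N].

Definition leg_index (n k l : nat) (i : k.-tuple 'I_n) (j : l.-tuple 'I_n)
    (x : leg k l) : 'I_n :=
  match x with inl a => tnth i a | inr b => tnth j b end.

Definition delta_part (n k l : nat) (p : {set {set leg k l}})
    (i : k.-tuple 'I_n) (j : l.-tuple 'I_n) : bool :=
  [forall B in p, forall x in (B : {set _}), forall y in (B : {set _}),
     leg_index i j x == leg_index i j y].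

(* Linear maps from the k-th to the l-th tensor power of C^n, given by their
   matrices in the standard bases: [T (j, i)] is the coefficient of
   [e_j1 (x) ... (x) e_jl] in the image of [e_i1 (x) ... (x) e_ik]. *)
Definition tensor_map (R : realType) (n k l : nat) : vectType R[i] :=
  {ffun (l.-tuple 'I_n) * (k.-tuple 'I_n) -> R[i]^o}.

Definition part_map (R : realType) (n k l : nat) (p : {set {set leg k l}}) :
    tensor_map R n k l :=
  [ffun ji : (l.-tuple 'I_n) * (k.-tuple 'I_n) => (delta_part p ji.2 ji.1)%:R].

(* The entries [u_(i1 j1) ... u_(ik jk)] of the k-th tensor power of [u]. *)
Definition tensor_power (R : realType) (n : nat) (A : cstarAlgType R)
    (u : 'M[A]_n) (k : nat) (i j : k.-tuple 'I_n) : A :=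
  \prod_(t < k) u (tnth i t) (tnth j t).

(* [T u^(x)k = u^(x)l T]. *)
Definition intertwiner (R : realType) (n : nat) (A : cstarAlgType R)
    (u : 'M[A]_n) (k l : nat) (T : tensor_map R n k l) : Prop :=
  forall (j : l.-tuple 'I_n) (i : k.-tuple 'I_n),
    \sum_(h : k.-tuple 'I_n) T (j, h) *: tensor_power u h i =
    \sum_(h : l.-tuple 'I_n) T (h, i) *: tensor_power u j h.

Definition easy_quantum_group (R : realType) (n : nat) (A : cstarAlgType R)
    (u : 'M[A]_n) (D : forall k l : nat, {set {set {set leg k l}}}) : Prop :=
  [/\ compact_matrix_quantum_group u,
      contains_symmetric_group u,
      contained_in_free_orthogonal u,
      partition_category D &
      forall (k l : nat) (T : tensor_map R n k l),
        intertwiner u T <->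
        T \in <<[seq part_map R n p | p <- enum (D k l)]>>%VS].

Definition eq_modulo (s : option nat) (a b : nat) : bool :=
  if s is Some m then a == b %[mod m] else a == b.

Definition balanced_parts (s : option nat) (k l : nat) :
    {set {set {set leg k l}}} :=
  [set p in parts k l |
     ~~ odd (k + l) &
     [forall B in p,
        eq_modulo s #|[set x in (B : {set _}) | odd (leg_label x)]|
                    #|[set x in (B : {set _}) | ~~ odd (leg_label x)]|]].

(* Main.v *)
Require Import Defs.
From mathcomp Require Import classical_sets.
From mathcomp Require Import all_boot all_algebra all_reals.
From mathcomp Require Import all_order all_fingroup all_solvable all_field.
From mathcomp Require Import complex ring lra zify.
From HB Require Import structures.

(* Entries sharing a row or a column, but not both, annihilate each other, even
   with any word between them, by half-commutation.  Hence a word in the entries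
   vanishes unless its row and column indices have the same kernel, and the row
   sums [r_a = \sum_c u a c] are half-commuting involutions with
   [(r_a r_b) ^ s = 1].  The products [r_a r_b] generate a commutative group, in
   which a balanced word in the [r_a] is trivial; this makes the vector of a
   balanced partition fixed, and Frobenius reciprocity turns it into an
   intertwiner.

   Conversely, an intertwiner is tested on two families of models.  Permutation
   matrices make it a function of the kernel of the index; the diagonal matrices
   whose entries are the reflections [[0, z; z^*, 0]], with [z] a root of unity,
   force its support to consist of indices with a balanced kernel.  The
   indicator function of a kernel is a combination of the maps [T_p] with [p]
   coarser than the kernel, and a coarsening of a balanced partition is balanced.

   The combinatorial statements follow from counting the odd legs of a block
   minus its even legs: this signed count changes sign when a diagram is turned
   or shifted by an odd number of legs, and the contributions of the middle row
   cancel in a vertical concatenation. *)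

Set Implicit Arguments.
Unset Strict Implicit.
Unset Printing Implicit Defensive.

Import Order.TTheory GRing.Theory Num.Theory.

Local Open Scope ring_scope.

(** * The C*-algebra of complex matrices *)

(** The limit is found as the lower limit: the supremum of the set [D] of numbers that are
    eventually below the sequence. *)
Lemma real_cauchy_complete (R : realType) (x_ : nat -> R) :
  (forall e : R, 0 < e -> exists N, forall p q : nat,
     (N <= p)%N -> (N <= q)%N -> `|x_ p - x_ q| < e) ->
  exists l : R, forall e : R, 0 < e -> exists N, forall p : nat,
     (N <= p)%N -> `|x_ p - l| < e.
Proof.
move=> xC; pose D : set R := fun t => exists N, forall p, (N <= p)%N -> t <= x_ p.
have DN e N : (forall p q, (N <= p)%N -> (N <= q)%N -> `|x_ p - x_ q| < e) ->
    D (x_ N - e) /\ ubound D (x_ N + e).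
  move=> xN; split=> [|t [N' tx]].
    by exists N => p Np; have := xN p N Np (leqnn _); rewrite ltr_distl => /andP[/ltW].
  have := xN (maxn N N') N (leq_maxl _ _) (leqnn _).
  rewrite ltr_distl => /andP[_ /ltW]; apply: le_trans.
  exact/tx/leq_maxr.
exists (sup D) => e e0; have [|N xN] := xC (e / 2); first lra.
exists N => p Np; have [D1 D2] := DN _ _ xN.
have := xN p N Np (leqnn _).
have h1 : sup D <= x_ N + e / 2 by apply: ge_sup D2; exists (x_ N - e / 2).
have h2 : x_ N - e / 2 <= sup D by apply: ub_le_sup D1; exists (x_ N + e / 2).
rewrite !ltr_distl => /andP[h3 h4]; apply/andP; split; lra.
Qed.

(** In [R[i]] the value [|z|] is again an element of [R[i]]; [modulus] and [vnorm] are the real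
    versions, since [cnorm] is real-valued and infima are taken in [R]. *)
HB.lock Definition modulus (R : realType) (z : R[i]) : R := complex.Re `|z|.

HB.lock Definition vnorm (R : realType) (n : nat) (u : 'rV[R[i]]_n) : R :=
  complex.Re (sqrtC (dotmx u u)).

Section ComplexModulus.
Variable R : realType.
Implicit Type z : R[i].

Definition toC (x : R) : R[i] := (x%:C)%C.

Lemma toCD (x y : R) : toC (x + y) = toC x + toC y.
Proof. exact: rmorphD. Qed.

Lemma toCM (x y : R) : toC (x * y) = toC x * toC y.
Proof. exact: rmorphM. Qed.

Lemma toCX (x : R) m : toC (x ^+ m) = toC x ^+ m.
Proof. exact: rmorphXn. Qed.

Lemma toCV (x : R) : toC x^-1 = (toC x)^-1.
Proof. exact: fmorphV. Qed.

Lemma toC_ge0 (x : R) : (0 <= toC x) = (0 <= x).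
Proof. exact: ler0c. Qed.

Lemma toC_gt0 (x : R) : (0 < toC x) = (0 < x).
Proof. exact: ltcR. Qed.

Lemma toC_le (x y : R) : (toC x <= toC y) = (x <= y).
Proof. exact: lecR. Qed.

Lemma toC_inj : injective toC.
Proof. exact: complexI. Qed.

Lemma toC_Re z : 0 <= z -> toC (complex.Re z) = z.
Proof. by move=> z0; apply: RRe_real; apply: ger0_real. Qed.

Lemma modulusE z : toC (modulus z) = `|z|.
Proof. rewrite modulus.unlock; exact/toC_Re/normr_ge0. Qed.

Lemma modulus_ge0 z : 0 <= modulus z.
Proof. by rewrite -toC_ge0 modulusE normr_ge0. Qed.

Lemma modulus0 : modulus (0 : R[i]) = 0.
Proof. by rewrite modulus.unlock normr0. Qed.

Lemma modulus_real (x : R) : 0 <= x -> modulus (toC x) = x.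
Proof. by move=> x0; apply: toC_inj; rewrite modulusE ger0_norm // toC_ge0. Qed.

Lemma Re_le_modulus z : `|complex.Re z| <= modulus z.
Proof. by rewrite modulus.unlock normc_def /= -sqrtr_sqr ler_wsqrtr // lerDl sqr_ge0. Qed.

Lemma Im_le_modulus z : `|complex.Im z| <= modulus z.
Proof. by rewrite modulus.unlock normc_def /= -sqrtr_sqr ler_wsqrtr // lerDr sqr_ge0. Qed.

Lemma modulus_le_ReIm z : modulus z <= `|complex.Re z| + `|complex.Im z|.
Proof.
rewrite modulus.unlock normc_def /= -(@ler_pXn2r _ 2) ?nnegrE ?addr_ge0 ?sqrtr_ge0 //.
rewrite sqr_sqrtr ?addr_ge0 ?sqr_ge0 // sqrrD !real_normK ?num_real //.
by rewrite lerD2r lerDl mulrn_wge0 // mulr_ge0.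
Qed.

End ComplexModulus.

(** * Hermitian norm of row vectors *)

Section VectorNorm.
Variables (R : realType) (n : nat).
Implicit Types (u v : 'rV[R[i]]_n) (x y : 'M[R[i]]_n).
Local Notation "''[' u , v ]" := (dotmx u v) : ring_scope.

Lemma vnormE u : toC (vnorm u) = sqrtC '[u, u].
Proof. by rewrite vnorm.unlock; apply: toC_Re; rewrite sqrtC_ge0 dnorm_ge0. Qed.

Lemma vnorm_ge0 u : 0 <= vnorm u.
Proof. by rewrite -toC_ge0 vnormE sqrtC_ge0 dnorm_ge0. Qed.

Lemma vnormD u v : vnorm (u + v) <= vnorm u + vnorm v.
Proof.
have [w wE] : exists w, w = u + v by exists (u + v).
rewrite -toC_le toCD -wE !vnormE wE; exact: triangle_lerif.
Qed.

Lemma vnormZ (c : R[i]) u : vnorm (c *: u) = modulus c * vnorm u.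
Proof.
have [w wE] : exists w, w = c *: u by exists (c *: u).
apply: toC_inj; rewrite toCM -wE !vnormE modulusE wE.
by rewrite dnormZ sqrtCM ?nnegrE ?dnorm_ge0 ?exprn_ge0 // sqrCK.
Qed.

Lemma vnorm_eq0 u : vnorm u = 0 -> u = 0.
Proof.
move=> /(congr1 (fun t => toC t)); rewrite vnormE => /eqP.
by rewrite sqrtC_eq0 dnorm_eq0 => /eqP.
Qed.

Lemma vnorm0 : vnorm (0 : 'rV[R[i]]_n) = 0.
Proof. by rewrite -(scale0r (0 : 'rV_n)) vnormZ modulus0 mul0r. Qed.

Lemma vnorm_sqr u : toC (vnorm u ^+ 2) = '[u, u].
Proof. by rewrite toCX vnormE sqrtCK. Qed.

Lemma dotmx_le u v : modulus ('[u, v]) <= vnorm u * vnorm v.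
Proof.
rewrite -toC_le toCM !vnormE modulusE.
exact: CauchySchwarz_sqrt.
Qed.

Definition adjoint x : 'M[R[i]]_n := map_mx Num.conj x^T.

Lemma adjointK : involutive adjoint.
Proof. by move=> x; apply/matrixP=> i j; rewrite !mxE conjCK. Qed.

Lemma adjointM x y : adjoint (x *m y) = adjoint y *m adjoint x.
Proof. by rewrite /adjoint trmx_mul map_mxM. Qed.

Lemma dotmx_adjoint u v x : '[u *m x, v] = '[u, v *m adjoint x].
Proof.
have xK : map_mx Num.conj (adjoint x)^T = x := adjointK x.
by rewrite !dotmxE trmx_mul map_mxM xK mulmxA.
Qed.

End VectorNorm.

(** * Operator norm of matrices acting on row vectors *)

Section OperatorNorm.
Variables (R : realType) (n : nat).
Implicit Types (u v : 'rV[R[i]]_n) (x y : 'M[R[i]]_n).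

Definition op_bound x (c : R) := forall u, vnorm (u *m x) <= c * vnorm u.

Definition opnorm x : R := inf [set c | 0 <= c /\ op_bound x c]%classic.

Lemma vnorm_sum (I : finType) (F : I -> 'rV[R[i]]_n) :
  vnorm (\sum_i F i) <= \sum_i vnorm (F i).
Proof.
elim/big_ind2: _ => [|u a v b ua vb|//]; first by rewrite vnorm0.
exact: le_trans (vnormD _ _) (lerD ua vb).
Qed.

Lemma entry_le_vnorm u i : modulus (u 0 i) <= vnorm u.
Proof.
rewrite -(@ler_pXn2r _ 2) ?nnegrE ?vnorm_ge0 //; last first.
  exact: modulus_ge0.
rewrite -toC_le vnorm_sqr toCX modulusE normCK.
rewrite dotmxE mxE (bigD1 i) //= !mxE lerDl.
by apply: sumr_ge0 => j _; rewrite !mxE mul_conjC_ge0.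
Qed.

Lemma vnorm_delta i : vnorm (delta_mx 0 i : 'rV[R[i]]_n) = 1.
Proof.
apply: toC_inj; rewrite vnormE dotmxE mxE (bigD1 i) //= big1 => [|j ji].
  by rewrite !mxE !eqxx addr0 conjC1 mulr1 sqrtC1.
by rewrite !mxE (negPf ji) andbF mul0r.
Qed.

(** A crude bound with two uses: it makes the set of bounds nonempty, so that its infimum is
    meaningful, and it turns entrywise convergence into convergence in norm. *)
Lemma op_bound_entries x :
  op_bound x (\sum_i \sum_j modulus (x i j)).
Proof.
move=> u; rewrite (mulmx_sum_row u x) mulr_suml.
apply: le_trans (vnorm_sum _) _; apply: ler_sum => i _.
rewrite vnormZ mulrC ler_pM ?vnorm_ge0 ?entry_le_vnorm //.
  exact: modulus_ge0.
rewrite [row i x]row_sum_delta; apply: le_trans (vnorm_sum _) _.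
by apply: ler_sum => j _; rewrite vnormZ vnorm_delta mulr1 mxE.
Qed.

Lemma entries_ge0 x : 0 <= \sum_i \sum_j modulus (x i j).
Proof. by do 2!apply: sumr_ge0 => ? _; exact: modulus_ge0. Qed.

Lemma opnorm_has_inf x : has_inf [set c | 0 <= c /\ op_bound x c]%classic.
Proof.
split; last by exists 0 => c [].
by exists (\sum_i \sum_j modulus (x i j)); split;
  [exact: entries_ge0 | exact: op_bound_entries].
Qed.

Lemma opnorm_ge0 x : 0 <= opnorm x.
Proof. by apply: lb_le_inf => [|c []//]; case: (opnorm_has_inf x). Qed.

Lemma opnorm_le x c : 0 <= c -> op_bound x c -> opnorm x <= c.
Proof. by move=> c0 xc; apply: ge_inf => //; case: (opnorm_has_inf x). Qed.

Lemma opnormP x : op_bound x (opnorm x).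
Proof.
move=> u; have [u0|] := eqVneq (vnorm u) 0.
  by rewrite (vnorm_eq0 u0) mul0mx vnorm0 mulr0.
move=> nzu; have u0 : 0 < vnorm u by rewrite lt_neqAle eq_sym nzu vnorm_ge0.
rewrite -ler_pdivrMr //; apply: lb_le_inf; first by case: (opnorm_has_inf x).
by move=> c [_ xc]; rewrite ler_pdivrMr.
Qed.

Lemma opnorm_eq0 x : opnorm x = 0 -> x = 0.
Proof.
move=> x0; apply/row_matrixP => i; rewrite row0; apply: vnorm_eq0.
apply/eqP; rewrite eq_le vnorm_ge0 andbT.
by have := opnormP x (delta_mx 0 i); rewrite -rowE x0 mul0r.
Qed.

Lemma opnormD x y : opnorm (x + y) <= opnorm x + opnorm y.
Proof.
apply: opnorm_le => [|u]; first by rewrite addr_ge0 ?opnorm_ge0.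
rewrite mulmxDr mulrDl; apply: le_trans (vnormD _ _) _.
by rewrite lerD ?opnormP.
Qed.

Lemma opnormM x y : opnorm (x *m y) <= opnorm x * opnorm y.
Proof.
apply: opnorm_le => [|u]; first by rewrite mulr_ge0 ?opnorm_ge0.
rewrite mulmxA [opnorm x * _]mulrC -mulrA; apply: le_trans (opnormP _ _) _.
by rewrite ler_wpM2l ?opnorm_ge0 ?opnormP.
Qed.

Lemma opnormZ_le (c : R[i]) x : opnorm (c *: x) <= modulus c * opnorm x.
Proof.
have c0 : 0 <= modulus c by exact: modulus_ge0.
apply: opnorm_le => [|u]; first by rewrite mulr_ge0 ?opnorm_ge0.
by rewrite -scalemxAr vnormZ -mulrA ler_wpM2l ?opnormP.
Qed.

(** The inequality [opnormZ_le], applied to the inverse of [c] and to [c *: x], gives the opposite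
    one. *)
Lemma opnormZ (c : R[i]) x : ((opnorm (c *: x))%:C = `|c| * (opnorm x)%:C)%C.
Proof.
rewrite -modulusE; apply: etrans (toCM _ _); congr toC.
apply/eqP; rewrite eq_le opnormZ_le /=.
have [->|c0] := eqVneq c 0.
  by rewrite modulus0 mul0r opnorm_ge0.
have cE : modulus (c^-1) = (modulus c)^-1.
  by apply: toC_inj; rewrite modulusE toCV modulusE normfV.
rewrite -[in X in X <= _](scalerK c0 x) -ler_pdivlMl; last first.
  by rewrite -toC_gt0 modulusE normr_gt0.
by rewrite -cE opnormZ_le.
Qed.

(** With w = u x^*, the square of |w| is <u, w x>, at most |u| |x| |w| by Cauchy-Schwarz; then
    divide by |w|. *)
Lemma opnorm_adjoint_le x : opnorm (adjoint x) <= opnorm x.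
Proof.
apply: opnorm_le => [|u]; first exact: opnorm_ge0.
set w := u *m _; have [->|w0] := eqVneq (vnorm w) 0.
  by rewrite mulr_ge0 ?opnorm_ge0 ?vnorm_ge0.
have wp : 0 < vnorm w by rewrite lt_neqAle eq_sym w0 vnorm_ge0.
rewrite -(ler_pM2r wp) -expr2.
have -> : vnorm w ^+ 2 = modulus (dotmx u (w *m x)).
  rewrite -[x]adjointK -dotmx_adjoint -/w -vnorm_sqr.
  by rewrite modulus_real ?exprn_ge0 ?vnorm_ge0.
apply: le_trans (dotmx_le _ _) _.
rewrite [_ * vnorm u]mulrC -mulrA ler_wpM2l ?vnorm_ge0 //.
exact: opnormP.
Qed.

Lemma opnorm_adjoint x : opnorm (adjoint x) = opnorm x.
Proof.
apply/eqP; rewrite eq_le opnorm_adjoint_le /=.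
by have := opnorm_adjoint_le (adjoint x); rewrite adjointK.
Qed.

Lemma opnorm_cstar x : opnorm (adjoint x *m x) = opnorm x ^+ 2.
Proof.
apply/eqP; rewrite eq_le; apply/andP; split.
  by apply: le_trans (opnormM _ _) _; rewrite opnorm_adjoint expr2.
(* Here |u y|^2 = <u, u y y^*> is at most |y y^*| |u|^2, so the square root of |y y^*| is a bound
   for y. *)
rewrite -opnorm_adjoint; set y := adjoint x; rewrite -[x]adjointK -/y.
have h0 := opnorm_ge0 (y *m adjoint y).
rewrite -(sqr_sqrtr h0) ler_pXn2r ?nnegrE ?opnorm_ge0 ?sqrtr_ge0 //.
apply: opnorm_le => [|u]; first exact: sqrtr_ge0.
rewrite -(@ler_pXn2r _ 2) ?nnegrE ?mulr_ge0 ?vnorm_ge0 ?sqrtr_ge0 //.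
rewrite exprMn sqr_sqrtr //.
have -> : vnorm (u *m y) ^+ 2 = modulus (dotmx u (u *m (y *m adjoint y))).
  rewrite mulmxA -dotmx_adjoint -vnorm_sqr.
  by rewrite modulus_real ?exprn_ge0 ?vnorm_ge0.
apply: le_trans (dotmx_le _ _) _.
rewrite mulrC expr2 mulrA; apply: ler_wpM2r; first exact: vnorm_ge0.
exact: opnormP.
Qed.

Lemma entry_le_opnorm x i j : modulus (x i j) <= opnorm x.
Proof.
have := opnormP x (delta_mx 0 i); rewrite vnorm_delta mulr1 -rowE.
by apply: le_trans; have := entry_le_vnorm (row i x) j; rewrite mxE.
Qed.

(** Entries are dominated by the norm, so their real and imaginary parts converge; as there are
    finitely many entries, one rank serves them all. *)
Lemma opnorm_complete (x_ : nat -> 'M[R[i]]_n) :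
  (forall e : R, 0 < e -> exists N, forall p q : nat,
     (N <= p)%N -> (N <= q)%N -> opnorm (x_ p - x_ q) < e) ->
  exists l : 'M[R[i]]_n, forall e : R, 0 < e -> exists N, forall p : nat,
     (N <= p)%N -> opnorm (x_ p - l) < e.
Proof.
move=> xC.
have lim (f : R[i] -> R) : (forall z w, f (z - w) = f z - f w) ->
    (forall z, `|f z| <= modulus z) -> forall ij : 'I_n * 'I_n,
    exists l : R, forall e : R, 0 < e -> exists N, forall p : nat,
      (N <= p)%N -> `|f (x_ p ij.1 ij.2) - l| < e.
  move=> fB fle [i j]; apply: real_cauchy_complete => e /xC[N xN].
  exists N => p q Np Nq; apply: le_lt_trans (xN p q Np Nq) => /=.
  by rewrite -fB; apply: le_trans (entry_le_opnorm _ i j); rewrite !mxE.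
have [||a aP] := fin_all_exists (lim (@complex.Re R) _ _); [|exact: Re_le_modulus|].
  by move=> [? ?] [? ?].
have [||b bP] := fin_all_exists (lim (@complex.Im R) _ _); [|exact: Im_le_modulus|].
  by move=> [? ?] [? ?].
pose l := \matrix_(i < n, j < n) (a (i, j) +i* b (i, j))%C.
exists l => e e0.
(* The n^2 entries contribute at most 2d each, in total e n^2 / (n^2 + 1) < e; the successor also
   covers n = 0. *)
pose d := e / (2 * (n * n).+1%:R).
have d0 : 0 < d by rewrite divr_gt0 // mulr_gt0 // ltr0n.
have [Na NaP] := fin_all_exists (fun ij => aP ij d d0).
have [Nb NbP] := fin_all_exists (fun ij => bP ij d d0).
exists (\max_ij maxn (Na ij) (Nb ij)) => p Np.
apply: (@le_lt_trans _ _ (\sum_(i < n) \sum_(j < n) (2 * d))).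
  apply: le_trans (opnorm_le (entries_ge0 _) (@op_bound_entries _)) _.
  apply: ler_sum => i _; apply: ler_sum => j _.
  have := leq_trans (leq_bigmax (i, j)) Np; rewrite geq_max => /andP[pa pb].
  apply: le_trans (modulus_le_ReIm _) _; rewrite !mxE.
  have := NaP (i, j) p pa; have := NbP (i, j) p pb; rewrite /=.
  case: (x_ p i j) => /= r t /ltW h1 /ltW h2.
  by rewrite [2 * d]mulr_natl mulr2n lerD.
rewrite !sumr_const card_ord -mulrnA -[_ *+ (n * n)]mulr_natl /d.
set N := (n * n)%N.
have N0 : N.+1%:R != 0 :> R by rewrite pnatr_eq0.
have -> : N%:R * (2 * (e / (2 * N.+1%:R))) = e * (N%:R / N.+1%:R).
  by move: (N.+1%:R) N0 => M M0; field.
by rewrite gtr_pMr // ltr_pdivrMr ?ltr0n // mul1r ltr_nat ltnSn.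
Qed.

End OperatorNorm.

Section MatrixAlgebra.
Variables (R : realType) (d : nat).
Local Notation B := ('M[R[i]]_d.+1).

Fact adjointD : {morph @adjoint R d.+1 : x y / x + y}.
Proof. by move=> x y; rewrite /adjoint linearD map_mxD. Qed.

Fact adjointZ (c : R[i]) (x : B) : adjoint (c *: x) = Num.conj c *: adjoint x.
Proof. by rewrite /adjoint linearZ map_mxZ. Qed.

(** The size is a successor because algebras are nonzero; sizes 1 and 2 provide the models used
    below. *)
HB.instance Definition _ := isCStarAlgebra.Build R B
  (@adjointK R d.+1) adjointD adjointZ (@adjointM R d.+1)
  (@opnorm_eq0 R d.+1) (@opnormD R d.+1) (@opnormZ R d.+1)
  (@opnormM R d.+1) (@opnorm_complete R d.+1) (@opnorm_cstar R d.+1).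

End MatrixAlgebra.

(** * Words in half-commuting involutions *)

Section AlternatingWords.
Variable T : nzRingType.

(** In the expanded product, letters two places apart come from the same family and must carry the
    same index, so only the words alternating between one [X a] and one [Y b] survive. For m < 2 the
    double sum would count terms with multiplicity. *)
Lemma alternating_sum (I : finType) (m : nat) (X Y : I -> T) : (1 < m)%N ->
  (forall a b c, a != c -> X a * Y b * X c = 0) ->
  (forall a b c, a != c -> Y a * X b * Y c = 0) ->
  alternating m (\sum_a X a) (\sum_b Y b) = \sum_a \sum_b alternating m (X a) (Y b).
Proof.
case: m => [|[|m]] // _; elim: m X Y => [|m IHm] X Y XYX YXY.
  rewrite /= !mulr1 mulr_suml; apply: eq_bigr => a _.
  by rewrite mulr_sumr; apply: eq_bigr => b _; rewrite mulr1.
rewrite -[LHS]/(_ * alternating m.+2 _ _) IHm // mulr_suml.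
apply: eq_bigr => a _; rewrite mulr_sumr; apply: eq_bigr => b _.
rewrite mulr_sumr (bigD1 a) //= big1 ?addr0 // => c ca.
by rewrite !mulrA XYX ?mul0r // eq_sym.
Qed.

Lemma alternating_tensor (m : nat) (a b a' b' : T) :
  {in [:: a; b] & [:: a'; b'], forall x y, x * y = y * x} ->
  alternating m (a * a') (b * b') = alternating m a b * alternating m a' b'.
Proof.
elim: m a b a' b' => [|m IHm] a b a' b' cab; first by rewrite mulr1.
rewrite /= IHm; last first.
  move=> x y; rewrite !inE orbC => x_ab; rewrite orbC => y_ab.
  by apply: cab; rewrite !inE.
rewrite !mulrA; congr (_ * _); rewrite -!mulrA; congr (_ * _).
have: {in [:: a; b], forall x, a' * x = x * a'}.
  by move=> x xab; rewrite [RHS]cab ?mem_head.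
elim: m {IHm} a b {cab} => [|m IHm] a b ca; first by rewrite mulr1 mul1r.
rewrite /= mulrA ca ?inE ?eqxx ?orbT // -!mulrA IHm // => x.
by rewrite !inE orbC => xab; rewrite ca // !inE.
Qed.

Lemma alternating0 (m : nat) (a b : T) :
  (1 < m)%N -> a = 0 \/ b = 0 -> alternating m a b = 0.
Proof. by case: m => [|[|m]] //= _ [|] ->; rewrite !(mul0r, mulr0). Qed.

End AlternatingWords.

Section InvolutionWords.
Variables (T : nzRingType) (I : finType) (r : I -> T).
Hypothesis r_sqr : forall a, r a * r a = 1.
Hypothesis r_half : forall a b c, r a * r b * r c = r c * r b * r a.

(** The power is the alternating word of length 2m; cut in the middle, it is a word of length m
    followed by its continuation, which the hypothesis identifies with the inverse of the first
    half. *)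
Lemma alternating_inv (m : nat) (a b : I) :
  alternating m (r a) (r b) = alternating m (r b) (r a) ->
  (r a * r b) ^+ m = 1.
Proof.
have alt2 m' x y : alternating m'.*2 (r x) (r y) = (r x * r y) ^+ m'.
  by elim: m' => [|m' IHm]; rewrite ?expr0 // doubleS /= IHm mulrA -exprS.
(* [alternating m x y] is inverse to the reversed word, which is one of
   [alternating m x y] and [alternating m y x]. *)
have inv x y : alternating m (r x) (r y) *
    (if odd m then alternating m (r x) (r y) else alternating m (r y) (r x)) = 1.
  elim: m x y => [|m' IHm] x y; first by rewrite mulr1.
  have altS (p q : I) k : alternating k.+1 (r p) (r q) =
      alternating k (r p) (r q) * (if odd k then r q else r p).
    elim: k p q => [|k IHk] p q; first by rewrite /= mulr1 mul1r.
    by rewrite -[LHS]/(_ * alternating k.+1 _ _) IHk /= mulrA; case: (odd k).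
  rewrite {1}altS; have := IHm x y; rewrite [odd m'.+1]/=.
  by case: (odd m') => /= e; rewrite -mulrA [X in _ * X]mulrA r_sqr mul1r.
move=> mix; rewrite -alt2.
have -> : alternating m.*2 (r a) (r b) = alternating m (r a) (r b) *
   (if odd m then alternating m (r b) (r a) else alternating m (r a) (r b)).
  suff altD k l (x y : I) : alternating (k + l) (r x) (r y) = alternating k (r x) (r y) *
      (if odd k then alternating l (r y) (r x) else alternating l (r x) (r y)).
    by rewrite -addnn altD.
  elim: k x y => [|k IHk] x y; first by rewrite mul1r.
  by rewrite addSn /= IHk -mulrA; case: (odd k).
have := inv a b; rewrite -mix; case: ifP => _ //.
Qed.

(** Positions start from 0, so [parity_count false] counts the first, third, ... letters. *)
Definition parity_count (q : bool) (w : seq I) (a : I) : nat :=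
  \sum_(p < size w) ((odd p == q) && (nth a w p == a)).

Lemma parity_count_cons q b w a :
  parity_count q (b :: w) a = ((~~ q && (b == a)) + parity_count (~~ q) w a)%N.
Proof.
rewrite /parity_count big_ord_recl /=; congr (_ + _)%N; last first.
  by apply: eq_bigr => i _; rewrite /=; case: (odd i); case: (q).
Qed.

Variable z : I.
Let g (q : bool) a := if q then r z * r a else r a * r z.

Let gC p q a b : g p a * g q b = g q b * g p a.
Proof.
rewrite /g; case: p q => [] []; rewrite !mulrA.
- by rewrite -!mulrA; congr (_ * _); rewrite !mulrA r_half.
- by rewrite r_half -mulrA r_sqr mulr1 -[r b * r z * r z]mulrA r_sqr mulr1.
- rewrite -[r a * r z * r z]mulrA r_sqr mulr1.
  by rewrite r_half -mulrA r_sqr mulr1.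
- by rewrite r_half.
Qed.

(** Inserting r_z^2 = 1 inside each pair of consecutive letters, r_a r_b = (r_a r_z)(r_z r_b), turns
    the word into a product of elements [g q a] with [q] alternating (the word [W]). By
    half-commutation all these commute, so they can be collected letter by letter. *)
Lemma involution_word (w : seq I) : ~~ odd (size w) ->
  \prod_(a <- w) r a =
  \prod_a (g false a ^+ parity_count false w a * g true a ^+ parity_count true w a).
Proof.
move=> w2; pose W := fix W q (w : seq I) := if w is a :: w' then g q a * W (~~ q) w' else 1.
have -> : \prod_(a <- w) r a = W false w.
  have [k sk] := ubnP (size w); elim: k w w2 sk => // k IHk [|a [|b w]] //=.
    by rewrite big_nil.
  rewrite negbK => w2 sk; rewrite !big_cons IHk //; last by lia.
  by rewrite /g !mulrA -[r a * r z * r z]mulrA r_sqr mulr1.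
have WE q v : W q v =
    \prod_a (g q a ^+ parity_count false v a * g (~~ q) a ^+ parity_count true v a).
  elim: v q => [|b v IHv] q /=.
    by rewrite big1 // => a _; rewrite /parity_count !big_ord0 mulr1.
  rewrite IHv negbK.
  have -> : g q b = \prod_a (if b == a then g q a else 1).
    by rewrite -big_mkcond /= (big_pred1 b).
  rewrite -prodrM_comm => [|i j _ _]; last first.
    rewrite /GRing.comm; case: ifP => _; last by rewrite mul1r mulr1.
    rewrite mulrA -[RHS]mulrA; set A := _ ^+ _; set B := _ ^+ _.
    have cA : GRing.comm (g q i) A by apply/commrX/gC.
    have cB : GRing.comm (g q i) B by apply/commrX/gC.
    by rewrite cA -!mulrA cB.
  apply: eq_bigr => a _; rewrite !parity_count_cons /= add0n.
  rewrite mulrA; set A := g (~~ q) a ^+ _; set B := g q a ^+ _.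
  have cAB : A * B = B * A by apply/commrX/commr_sym/commrX/gC.
  case: (b == a); last by rewrite mul1r cAB.
  by rewrite exprD expr1 -!mulrA cAB.
by rewrite WE.
Qed.

End InvolutionWords.

Section BalancedInvolutionWords.
Variables (T : nzRingType) (I : finType) (r : I -> T) (M : nat).
Hypothesis r_sqr : forall a, r a * r a = 1.
Hypothesis r_half : forall a b c, r a * r b * r c = r c * r b * r a.
Hypothesis r_mix : forall a b, (r a * r b) ^+ M = 1.

(** With z the first letter, r_a r_z and r_z r_a are mutually inverse and their powers of exponent
    [M] are trivial, so only the difference of the two counts modulo [M] matters. For s infinite,
    [M] is 0 and congruence is equality. *)
Lemma balanced_word (w : seq I) : ~~ odd (size w) ->
  (forall a, parity_count false w a = parity_count true w a %[mod M]) ->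
  \prod_(a <- w) r a = 1.
Proof.
case: w => [|z w]; first by rewrite big_nil.
move=> w2 bal; rewrite (involution_word r_sqr r_half z w2) big1 // => a _.
have key x y p q : (x * y = 1) -> (y * x = 1) -> y ^+ M = 1 -> (p <= q)%N ->
    p = q %[mod M] -> x ^+ p * y ^+ q = 1 :> T.
  move=> xy yx y1 pq /esym/eqP; rewrite eqn_mod_dvd // => /dvdnP[k kE].
  rewrite -(subnKC pq) exprD kE mulnC exprM y1 expr1n mulr1.
  by rewrite -exprMn_comm ?xy ?expr1n // /GRing.comm xy yx.
have zz : r a * r z * (r z * r a) = 1.
  by rewrite mulrA -[r a * r z * r z]mulrA r_sqr mulr1.
have aa : r z * r a * (r a * r z) = 1.
  by rewrite mulrA -[r z * r a * r a]mulrA r_sqr mulr1.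
have [le|/ltnW le] := leqP (parity_count false (z :: w) a)
                           (parity_count true (z :: w) a).
  by apply: key (bal a).
have c : GRing.comm (r a * r z) (r z * r a) by rewrite /GRing.comm zz aa.
by rewrite (commrX _ (commr_sym (commrX _ (commr_sym c)))) key.
Qed.

End BalancedInvolutionWords.

(** * Balanced partitions give intertwiners *)

Section HyperoctahedralAlgebra.
Variables (R : realType) (n : nat) (s : option nat).
Hypothesis hs : if s is Some m then (1 < m)%N else true.
Variables (A : cstarAlgType R) (u : 'M[A]_n).
Hypothesis hu : hyperoctahedral_series_rel s u.

Lemma star0 (B : cstarAlgType R) : star (0 : B) = 0.
Proof. by apply: (addrI (star 0)); rewrite -starD !addr0. Qed.

Lemma star1 (B : cstarAlgType R) : star (1 : B) = 1.
Proof.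
by rewrite -[LHS]mul1r -{1}[1](@starK R B) -starM mul1r starK.
Qed.

Lemma star_sum (B : cstarAlgType R) (I : Type) (r : seq I) (P : pred I) (F : I -> B) :
  star (\sum_(i <- r | P i) F i) = \sum_(i <- r | P i) star (F i).
Proof. exact: (big_morph _ (@starD R B) (star0 B)). Qed.

Lemma rel_star i j : star (u i j) = u i j.
Proof. by case: hu => [[h _ _] _ _ _]. Qed.

Lemma rel_row i j : \sum_k u i k * u j k = (i == j)%:R.
Proof.
case: hu => [[_ h _] _ _ _].
have := congr1 (fun X : 'M_n => X i j) h; rewrite !mxE => <-.
by apply: eq_bigr => k _; rewrite mxE.
Qed.

Lemma rel_col i j : \sum_k u k i * u k j = (i == j)%:R.
Proof.
case: hu => [[_ _ h] _ _ _].
have := congr1 (fun X : 'M_n => X i j) h; rewrite !mxE => <-.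
by apply: eq_bigr => k _; rewrite mxE.
Qed.

Lemma rel_half i1 j1 i2 j2 i3 j3 :
  u i1 j1 * u i2 j2 * u i3 j3 = u i3 j3 * u i2 j2 * u i1 j1.
Proof. by case: hu. Qed.

Lemma rel_mix m : s = Some m -> forall i1 j1 i2 j2,
  alternating m (u i1 j1) (u i2 j2) = alternating m (u i2 j2) (u i1 j1).
Proof. by move=> sm; move: hu; rewrite sm; case. Qed.

Definition clash (x y : 'I_n * 'I_n) := (x.1 == y.1) != (x.2 == y.2).
Local Notation U x := (u x.1 x.2).

Lemma clash_sym x y : clash x y = clash y x.
Proof. by rewrite /clash [x.1 == _]eq_sym [x.2 == _]eq_sym. Qed.

Lemma clash_row a c d : c != d -> clash (a, c) (a, d).
Proof. by rewrite /clash /= eqxx; case: (c == d). Qed.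

Lemma clash_mul x y : clash x y -> U x * U y = 0.
Proof.
case: hu => _ h _ _; case: x y => [i j] [k l]; rewrite /clash /=.
have [<-|ik] := eqVneq i k; have [<-|jl] := eqVneq j l => //= _.
  by have [] := h i j l jl.
by have [] := h j i k ik.
Qed.

(* One inserts [\sum_k u_ik ^ 2 = 1], of which only the term [u_y ^ 2] survives,
   and half-commutes one factor [u_y] past the middle letter. *)
Lemma clash_mul3 x y c : clash x y -> U x * U c * U y = 0.
Proof.
move=> xy.
have cube : U y * U y * U y = U y.
  rewrite -[RHS]mulr1.
  have <- : \sum_k u y.1 k * u y.1 k = 1 by rewrite rel_row eqxx.
  rewrite (bigD1 y.2) //= mulrDr mulr_sumr big1 ?addr0 ?mulrA // => k ky.
  by rewrite mulrA (@clash_mul (y.1, y.2) (y.1, k)) ?mul0r //; apply: clash_row; rewrite eq_sym.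
rewrite -cube.
have -> : U x * U c * (U y * U y * U y) = U x * (U c * U y * U y) * U y.
  by rewrite !mulrA.
by rewrite rel_half !mulrA clash_mul ?mul0r.
Qed.

Definition word (w : seq ('I_n * 'I_n)) : A := \prod_(x <- w) U x.

(** Half-commutation moves u_x two places to the right, past two letters of the word, until at most
    one letter separates it from u_y. *)
Lemma clash_word x y w : clash x y -> U x * word w * U y = 0.
Proof.
move=> xy; have [k wk] := ubnP (size w).
elim: k w wk => // k IHk [|a [|b w]] /= wk; rewrite /word ?big_nil ?big_cons.
- by rewrite mulr1 clash_mul.
- by rewrite big_nil mulr1 clash_mul3.
rewrite mulrA mulrA rel_half -!mulrA [U x * _]mulrA.
by rewrite (IHk w) ?mulr0 //; lia.
Qed.

Lemma word_eq0 x y w : x \in w -> y \in w -> clash x y -> word w = 0.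
Proof.
have key z v (w1 w2 w3 : seq ('I_n * 'I_n)) :
    clash z v -> word (w1 ++ z :: w2 ++ v :: w3) = 0.
  move=> zv; rewrite /word big_cat big_cons big_cat big_cons /=.
  rewrite [U z * _]mulrA [_ * (U v * _)]mulrA (clash_word w2 zv).
  by rewrite mul0r mulr0.
move=> xw yw xy; case/splitPr: xw yw => w1 w2.
rewrite mem_cat inE => /or3P[yw|/eqP yx|yw]; last 2 first.
- by move: xy; rewrite yx /clash !eqxx.
- by case/splitPr: yw => w3 w4; apply: key.
case/splitPr: yw => w3 w4; rewrite -catA cat_cons; apply: key.
by rewrite clash_sym.
Qed.

Definition row_sum (a : 'I_n) : A := \sum_c u a c.

Lemma row_sum_sqr a : row_sum a * row_sum a = 1.
Proof.
have <- : \sum_k u a k * u a k = 1 by rewrite rel_row eqxx.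
rewrite /row_sum mulr_suml; apply: eq_bigr => c _.
rewrite mulr_sumr (bigD1 c) //= big1 ?addr0 // => d dc.
by apply: (@clash_mul (a, c) (a, d)); apply: clash_row; rewrite eq_sym.
Qed.

Lemma row_sum_half a b c :
  row_sum a * row_sum b * row_sum c = row_sum c * row_sum b * row_sum a.
Proof.
have E x y z : row_sum x * row_sum y * row_sum z =
    \sum_j \sum_k \sum_l u x j * u y k * u z l.
  rewrite /row_sum mulr_suml mulr_suml; apply: eq_bigr => j _.
  rewrite [u x j * _]mulr_sumr mulr_suml; apply: eq_bigr => k _.
  by rewrite mulr_sumr.
rewrite !E exchange_big /= [RHS]exchange_big /=; apply: eq_bigr => k _.
rewrite exchange_big /=; apply: eq_bigr => j _; apply: eq_bigr => l _.
exact: rel_half.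
Qed.

(** Only alternating words in two fixed entries survive in the expansion of an alternating word in
    two row sums, and the mixing relation applies to each. For s infinite the exponent is 0. *)
Lemma row_sum_mix a b : (row_sum a * row_sum b) ^+ odflt 0%N s = 1.
Proof.
case: s hs rel_mix => [m|] //= m1 mix.
apply: (alternating_inv row_sum_sqr).
have zero i j c d e : c != e -> u i c * u j d * u i e = 0.
  move=> ce; apply: (@clash_mul3 (i, c) (i, e) (j, d)).
  exact: clash_row.
rewrite /row_sum !alternating_sum //; try by move=> *; apply: zero.
rewrite exchange_big /=; apply: eq_bigr => c _; apply: eq_bigr => d _.
exact: mix.
Qed.

Lemma big_tuple_nil (V : nmodType) (I : finType) (F : 0.-tuple I -> V) :
  \sum_t F t = F [tuple].
Proof. by rewrite (big_pred1 [tuple]) // => t; apply/esym/eqP/tuple0. Qed.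

Lemma big_tuple_cons (V : nmodType) (I : finType) k (F : k.+1.-tuple I -> V) :
  \sum_t F t = \sum_a \sum_t F (cons_tuple a t).
Proof.
rewrite pair_big /= (reindex (fun p : I * k.-tuple I => cons_tuple p.1 p.2)) //=.
exists (fun t => (thead t, behead_tuple t)) => [[a t] _|t _].
  by rewrite /= theadE; congr pair; apply: val_inj.
by rewrite /= [RHS]tuple_eta; apply: val_inj.
Qed.

Lemma tensor_power_cons k a b (i j : k.-tuple 'I_n) :
  tensor_power u (cons_tuple a i) (cons_tuple b j) = u a b * tensor_power u i j.
Proof.
rewrite /tensor_power big_ord_recl; congr (_ * _).
by apply: eq_bigr => t _; rewrite !tnthS.
Qed.

Lemma tensor_power_nil (i j : 0.-tuple 'I_n) : tensor_power u i j = 1.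
Proof. by rewrite /tensor_power big_ord0. Qed.

Lemma tensor_power_word k (i j : k.-tuple 'I_n) :
  tensor_power u i j = word (zip i j).
Proof.
elim: k i j => [|k IHk] i j.
  by rewrite tensor_power_nil tuple0 (tuple0 j) /word big_nil.
case/tupleP: i => a i; case/tupleP: j => b j.
by rewrite tensor_power_cons /word /= big_cons IHk.
Qed.

Lemma star_word w : star (word w) = word (rev w).
Proof.
rewrite /word; elim: w => [|x w IHw]; first by rewrite !big_nil star1.
by rewrite rev_cons -cats1 big_cat big_seq1 big_cons starM IHw rel_star.
Qed.

Lemma sum_tensor_power k (i : k.-tuple 'I_n) :
  \sum_h tensor_power u i h = \prod_(a <- i) row_sum a.
Proof.
elim: k i => [|k IHk] i.
  by rewrite (tuple0 i) big_nil big_tuple_nil tensor_power_nil.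
case/tupleP: i => a i; rewrite big_tuple_cons /= big_cons -IHk mulr_suml.
apply: eq_bigr => b _; rewrite mulr_sumr; apply: eq_bigr => t _.
exact: tensor_power_cons.
Qed.

Lemma star_row_sum a : star (row_sum a) = row_sum a.
Proof. by rewrite /row_sum star_sum; apply: eq_bigr => c _; rewrite rel_star. Qed.

Lemma star_prod_row_sum (w : seq 'I_n) :
  star (\prod_(a <- w) row_sum a) = \prod_(a <- rev w) row_sum a.
Proof.
elim: w => [|x w IHw]; first by rewrite !big_nil star1.
by rewrite rev_cons -cats1 big_cat big_seq1 big_cons starM IHw star_row_sum.
Qed.

(** As [star] reverses words, the first letters of the two words are adjacent and collapse by the
    column relation. *)
Lemma tensor_power_unitary k (i j : k.-tuple 'I_n) :
  \sum_h star (tensor_power u h i) * tensor_power u h j = (i == j)%:R.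
Proof.
elim: k i j => [|k IHk] i j.
  by rewrite (tuple0 i) (tuple0 j) eqxx big_tuple_nil tensor_power_nil star1 mulr1.
case/tupleP: i => a i; case/tupleP: j => b j.
rewrite big_tuple_cons exchange_big /=.
transitivity (\sum_t star (tensor_power u t i) * (a == b)%:R * tensor_power u t j).
  apply: eq_bigr => t _; rewrite -rel_col mulr_sumr mulr_suml.
  by apply: eq_bigr => c _; rewrite !tensor_power_cons starM rel_star !mulrA.
have -> : (cons_tuple a i == cons_tuple b j) = (a == b) && (i == j) by [].
case: (a == b); last first.
  by rewrite big1 // => t _; rewrite mulr0 mul0r.
by rewrite -IHk; apply: eq_bigr => t _; rewrite mulr1.
Qed.

Section PartitionIntertwiner.
Variables (k l : nat) (p : {set {set leg k l}}).

Lemma delta_part_ker (i h : k.-tuple 'I_n) (j h' : l.-tuple 'I_n) :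
  (forall x y, (leg_index i j x == leg_index i j y) =
               (leg_index h h' x == leg_index h h' y)) ->
  delta_part p i j = delta_part p h h'.
Proof.
by move=> E; rewrite /delta_part; do 3!(apply: eq_forallb => ?; congr (_ ==> _)).
Qed.

(** Every leg contributes to this word the entry given by its two indices; two legs at which the
    kernels disagree would give clashing entries, and the word would vanish. *)
Lemma mixed_word_neq0 (i h : k.-tuple 'I_n) (j h' : l.-tuple 'I_n) :
  tensor_power u j h' * star (tensor_power u i h) != 0 ->
  forall x y, (leg_index i j x == leg_index i j y) =
              (leg_index h h' x == leg_index h h' y).
Proof.
rewrite !tensor_power_word star_word /word -big_cat /= -/(word _) => nz x y.
pose L (x : leg k l) := (leg_index i j x, leg_index h h' x).
have inL z : L z \in zip j h' ++ rev (zip i h).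
  rewrite mem_cat mem_rev /L; case: z => a /=; apply/orP; [right|left].
    have -> : (tnth i a, tnth h a) = nth (tnth i a, tnth h a) (zip i h) a.
      by rewrite nth_zip ?size_tuple // -!tnth_nth.
    by rewrite mem_nth // size_zip !size_tuple minnn.
  have -> : (tnth j a, tnth h' a) = nth (tnth j a, tnth h' a) (zip j h') a.
    by rewrite nth_zip ?size_tuple // -!tnth_nth.
  by rewrite mem_nth // size_zip !size_tuple minnn.
have [//|xy] := @eqVneq bool (leg_index i j x == leg_index i j y)
                             (leg_index h h' x == leg_index h h' y).
by move: nz; rewrite (word_eq0 (inL x) (inL y)) // eqxx.
Qed.

Hypothesis even_kl : ~~ odd (k + l).
Hypothesis bal : forall (i : k.-tuple 'I_n) (j : l.-tuple 'I_n),
  delta_part p i j -> forall c,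
  #|[set x | (leg_index i j x == c) && odd (leg_label x)]| =
  #|[set x | (leg_index i j x == c) && ~~ odd (leg_label x)]| %[mod odflt 0%N s].

(** The word [j ++ rev i] reads the legs counterclockwise from the lower left, that is by decreasing
    label: position p carries the label k + l - p, which has the parity of p since k + l is even. *)
Lemma parity_count_legs (i : k.-tuple 'I_n) (j : l.-tuple 'I_n) q c :
  parity_count q (j ++ rev i) c =
  #|[set x | (leg_index i j x == c) && (odd (leg_label x) == q)]|.
Proof.
rewrite /parity_count size_cat size_rev !size_tuple big_split_ord /=.
rewrite cardsE -sum1_card big_mkcond big_sumType /=.
rewrite addnC; congr (_ + _)%N.
  rewrite (reindex_inj rev_ord_inj) [RHS]big_mkcond /=; apply: eq_bigr => a _; rewrite unfold_in /=.
  have ka : (k - a.+1 < k)%N by rewrite ltn_subrL; case: (k) a => [[]|].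
  rewrite nth_cat size_tuple ltnNge leq_addr /= addKn nth_rev ?size_tuple //.
  have -> : (k - (k - a.+1).+1)%N = a by have := ltn_ord a; lia.
  rewrite -tnth_nth andbC.
  have -> : odd (l + (k - a.+1)) = ~~ odd a.
    by move: even_kl; rewrite !oddD oddB //=; case: (odd k); case: (odd l); case: (odd a).
  by case: (_ && _).
rewrite [RHS]big_mkcond; apply: eq_bigr => b _; rewrite unfold_in /=.
rewrite nth_cat size_tuple ltn_ord -tnth_nth andbC.
have -> : odd (k + (l - b)) = odd b.
  by move: even_kl; rewrite !oddD oddB 1?ltnW //; case: (odd k); case: (odd l); case: (odd b).
by case: (_ && _).
Qed.

(** The vector of [p] is invariant. In each nonzero term (h, h') has the same kernel as (i, j), so
    the coefficient may be replaced by that of (i, j); the remaining double sum factors as a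
    balanced word in the row sums. *)
Lemma part_map_fixed (i : k.-tuple 'I_n) (j : l.-tuple 'I_n) :
  \sum_h' \sum_h (delta_part p h h')%:R *: (tensor_power u j h' * star (tensor_power u i h))
  = (delta_part p i j)%:R.
Proof.
transitivity (\sum_(h' : l.-tuple 'I_n) \sum_(h : k.-tuple 'I_n)
    (delta_part p i j)%:R *: (tensor_power u j h' * star (tensor_power u i h))).
  apply: eq_bigr => h' _; apply: eq_bigr => h _.
  have [->|nz] := eqVneq (tensor_power u j h' * star (tensor_power u i h)) 0.
    by rewrite !scaler0.
  by rewrite (delta_part_ker (mixed_word_neq0 nz)).
case: (boolP (delta_part p i j)) => [pij|_]; last first.
  by rewrite big1 // => h' _; rewrite big1 // => h _; rewrite scale0r.
transitivity ((\sum_h' tensor_power u j h') * star (\sum_h tensor_power u i h)).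
  rewrite star_sum mulr_suml; apply: eq_bigr => h' _.
  by rewrite mulr_sumr; apply: eq_bigr => h _; rewrite scale1r.
rewrite !sum_tensor_power star_prod_row_sum -big_cat /=.
apply: (balanced_word row_sum_sqr row_sum_half row_sum_mix).
  by rewrite size_cat size_rev !size_tuple addnC.
move=> c; rewrite !parity_count_legs; have /esym := bal pij c.
have -> : [set x | (leg_index i j x == c) && odd (leg_label x)] =
  [set x | (leg_index i j x == c) && (odd (leg_label x) == true)].
  by apply/setP=> x; rewrite !inE eqb_id.
have -> : [set x | (leg_index i j x == c) && ~~ odd (leg_label x)] =
  [set x | (leg_index i j x == c) && (odd (leg_label x) == false)].
  by apply/setP=> x; rewrite !inE eqbF_neg.
by [].
Qed.

Lemma part_map_intertwiner : intertwiner u (part_map R n p).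
Proof.
move=> j i.
(* Frobenius reciprocity: each coefficient is expanded by [part_map_fixed], and summing over [h0]
   then forces h = i by unitarity. *)
transitivity (\sum_h0 \sum_h' \sum_h ((delta_part p h h')%:R : R[i]) *:
    (tensor_power u j h' * star (tensor_power u h0 h) * tensor_power u h0 i)).
  apply: eq_bigr => h0 _; rewrite ffunE /= scaler_nat -mulr_natl -part_map_fixed.
  rewrite mulr_suml; apply: eq_bigr => h' _.
  by rewrite mulr_suml; apply: eq_bigr => h _; rewrite -scalerAl.
rewrite exchange_big /=; apply: eq_bigr => h' _.
rewrite exchange_big /= ffunE /= (bigD1 i) //= [X in _ + X]big1 ?addr0 => [|h hi].
  rewrite -scaler_sumr; congr (_ *: _).
  under eq_bigr do rewrite -mulrA.
  by rewrite -mulr_sumr tensor_power_unitary eqxx mulr1.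
rewrite -scaler_sumr; under eq_bigr do rewrite -mulrA.
by rewrite -mulr_sumr tensor_power_unitary (negPf hi) mulr0 scaler0.
Qed.

End PartitionIntertwiner.
End HyperoctahedralAlgebra.

(** * The comultiplication *)

Section Comultiplication.
Variables (R : realType) (n : nat) (s : option nat).
Hypothesis hs : if s is Some m then (1 < m)%N else true.
Variables (A : cstarAlgType R) (u : 'M[A]_n).
Hypothesis hu : hyperoctahedral_series_rel s u.
Variables (T : cstarAlgType R) (f g : starHom A T).
Hypothesis fg : forall a b, f a * g b = g b * f a.

Let fgM a b c d : f a * g b * (f c * g d) = f (a * c) * g (b * d).
Proof. by rewrite !rmorphM /= -!mulrA; congr (_ * _); rewrite !mulrA fg. Qed.

Let v : 'M[T]_n := \matrix_(i, j) \sum_k f (u i k) * g (u k j).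

Let vv i j k l : v i j * v k l =
  \sum_a \sum_b f (u i a * u k b) * g (u a j * u b l).
Proof.
rewrite !mxE mulr_suml; apply: eq_bigr => a _.
by rewrite mulr_sumr; apply: eq_bigr => b _; rewrite fgM.
Qed.

Let row0 i a b : a != b -> u i a * u i b = 0.
Proof. by move=> ab; apply: (clash_mul hu (clash_row _ ab)). Qed.

Let row03 i j a b c : a != c -> u i a * u j b * u i c = 0.
Proof.
by move=> ac; apply: (@clash_mul3 _ _ _ _ _ hu (i, a) (i, c) (j, b)); apply: clash_row.
Qed.

(** Once these relations hold, universality provides the comultiplication. Only the commutation of
    the images of [f] and [g] is used. *)
Lemma comultiplication_rel : hyperoctahedral_series_rel s v.
Proof.
split; first split.
- move=> i j; rewrite !mxE star_sum; apply: eq_bigr => k _.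
  by rewrite starM -!starhom_star !(rel_star hu) fg.
- apply/matrixP=> i j; rewrite !mxE -(rmorph_nat f) -(rel_row hu) rmorph_sum /=.
  transitivity (\sum_k \sum_a \sum_b f (u i a * u j b) * g (u a k * u b k)).
    by apply: eq_bigr => k _; rewrite [v^T _ _]mxE vv.
  rewrite exchange_big /=; apply: eq_bigr => a _.
  rewrite exchange_big (bigD1 a) //= -mulr_sumr -rmorph_sum (rel_row hu) eqxx.
  rewrite rmorph1 mulr1 big1 ?addr0 // => b ba.
  by rewrite -mulr_sumr -rmorph_sum (rel_row hu) eq_sym (negPf ba) rmorph0 mulr0.
- apply/matrixP=> i j; rewrite !mxE -(rmorph_nat g) -(rel_col hu) rmorph_sum /=.
  transitivity (\sum_k \sum_a \sum_b f (u k a * u k b) * g (u a i * u b j)).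
    by apply: eq_bigr => k _; rewrite [v^T _ _]mxE vv.
  rewrite exchange_big /=; apply: eq_bigr => a _.
  rewrite exchange_big (bigD1 a) //= -mulr_suml -rmorph_sum (rel_col hu) eqxx.
  rewrite rmorph1 mul1r big1 ?addr0 // => b ba.
  by rewrite -mulr_suml -rmorph_sum (rel_col hu) eq_sym (negPf ba) rmorph0 mul0r.
- move=> i j k jk; split; rewrite vv big1 // => a _; rewrite big1 // => b _.
    have [<-|ab] := eqVneq a b; last by rewrite row0 // rmorph0 mul0r.
    by rewrite [X in g X]row0 ?rmorph0 ?mulr0.
  have [<-|ab] := eqVneq a b.
    by rewrite (@clash_mul _ _ _ _ _ hu (j, a) (k, a)) ?rmorph0 ?mul0r //
      /clash /= eqxx (negPf jk).
  by rewrite (@clash_mul _ _ _ _ _ hu (a, i) (b, i)) ?rmorph0 ?mulr0 //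
    /clash /= eqxx (negPf ab).
- move=> i1 j1 i2 j2 i3 j3.
  have E i j k l p q : v i j * v k l * v p q = \sum_a \sum_b \sum_c
      f (u i a * u k b * u p c) * g (u a j * u b l * u c q).
    rewrite vv mulr_suml; apply: eq_bigr => a _; rewrite mulr_suml.
    apply: eq_bigr => b _; rewrite mxE mulr_sumr; apply: eq_bigr => c _.
    exact: fgM.
  rewrite !E exchange_big /= [RHS]exchange_big /=; apply: eq_bigr => b _.
  rewrite exchange_big /=; apply: eq_bigr => a _; apply: eq_bigr => c _.
  by congr (f _ * g _); apply: (rel_half hu).
(* An alternating word in two sums reduces to alternating words in elementary tensors, each of which
   factors into one alternating word per tensor leg. *)
case: s hs (@rel_mix _ _ _ _ _ hu) => // m m1 mix i1 j1 i2 j2.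
have zero i j k l a b c : a != c ->
    f (u i a) * g (u a j) * (f (u k b) * g (u b l)) * (f (u i c) * g (u c j)) = 0.
  by move=> ac; rewrite !fgM row03 // rmorph0 mul0r.
rewrite !mxE !alternating_sum //; try by move=> *; apply: zero.
rewrite exchange_big /=; apply: eq_bigr => a _; apply: eq_bigr => b _.
rewrite !alternating_tensor; try by move=> x y;
  rewrite !inE => /orP[] /eqP-> /orP[] /eqP->; apply: fg.
have altf (h : starHom A T) x y : alternating m (h x) (h y) = h (alternating m x y).
  by elim: (m) x y => [|m' IHm] x y /=; rewrite ?rmorph1 // rmorphM IHm.
by rewrite !altf mix // [X in _ * g X]mix.
Qed.

End Comultiplication.

(** * Models, and the support of an intertwiner *)

Section MonomialModel.
Variables (R : realType) (n : nat) (s : option nat).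
Hypothesis hs : if s is Some m then (1 < m)%N else true.
Variables (B : cstarAlgType R) (sigma : 'S_n) (a : 'I_n -> B).

(** Trivial weights give the permutation matrices, hence the characters; the trivial permutation
    with reflections as weights gives the diagonal models. *)
Definition monomial : 'M[B]_n := \matrix_(i, j) if i == sigma j then a i else 0.

Lemma monomial_rel :
  (forall i, star (a i) = a i) -> (forall i, a i * a i = 1) ->
  (forall i j k, a i * a j * a k = a k * a j * a i) ->
  (forall m, s = Some m -> forall i j,
     alternating m (a i) (a j) = alternating m (a j) (a i)) ->
  hyperoctahedral_series_rel s monomial.
Proof.
move=> a_star a_sqr a_half a_mix; split; first split.
- by move=> i j; rewrite mxE; case: ifP; rewrite ?star0 ?a_star.
- apply/matrixP=> i j; rewrite !mxE (bigD1 (sigma^-1%g i)) //= big1 => [|k ki].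
    rewrite !mxE permKV eqxx addr0 [j == _]eq_sym.
    by have [<-|_] := eqVneq i j; rewrite ?a_sqr ?mulr0.
  by rewrite !mxE; have [ik|_] := eqVneq i (sigma k);
    [move: ki; rewrite ik permK eqxx | rewrite mul0r].
- apply/matrixP=> i j; rewrite !mxE (bigD1 (sigma i)) //= big1 => [|k ki].
    rewrite !mxE eqxx addr0 (inj_eq perm_inj).
    by have [_|_] := eqVneq i j; rewrite ?a_sqr ?mulr0.
  by rewrite !mxE (negPf ki) mul0r.
- move=> i j k jk; rewrite !mxE; split.
    have [->|_] := eqVneq i (sigma j); last by rewrite mul0r.
    by rewrite (inj_eq perm_inj) (negPf jk) mulr0.
  have [e|_] := eqVneq j (sigma i); last by rewrite mul0r.
  by rewrite -e eq_sym (negPf jk) mulr0.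
- move=> i1 j1 i2 j2 i3 j3; rewrite !mxE.
  by do 3!case: ifP => _; rewrite ?(mulr0, mul0r).
case: s hs a_mix => // m m1 /(_ _ erefl) mix i1 j1 i2 j2; rewrite !mxE.
case: ifP => _; last by rewrite !alternating0 //; [right|left].
by case: ifP => _ //; rewrite !alternating0 //; [left|right].
Qed.

Variables (A : cstarAlgType R) (u : 'M[A]_n) (f : starHom A B).
Hypothesis fu : forall i j, f (u i j) = monomial i j.

Lemma monomial_tensor_power k (i j : k.-tuple 'I_n) :
  f (tensor_power u i j) = if i == map_tuple sigma j then \prod_(c <- i) a c else 0.
Proof.
elim: k i j => [|k IHk] i j.
  by rewrite tensor_power_nil rmorph1 [map_tuple _ _]tuple0 (tuple0 i) eqxx big_nil.
case/tupleP: i => x i; case/tupleP: j => y j.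
rewrite tensor_power_cons rmorphM /= IHk fu mxE big_cons.
have -> : (cons_tuple x i == map_tuple sigma (cons_tuple y j)) =
  (x == sigma y) && (i == map_tuple sigma j) by [].
by case: (x == _); rewrite ?mul0r //; case: (i == _); rewrite ?mulr0.
Qed.

(** In a monomial model each row and column of a tensor power has a single possibly nonzero entry,
    so each side of the intertwining relation reduces to one term. *)
Lemma monomial_intertwiner k l (T : tensor_map R n k l) (i : k.-tuple 'I_n)
    (j : l.-tuple 'I_n) : intertwiner u T ->
  T (map_tuple sigma j, map_tuple sigma i) *: \prod_(c <- map_tuple sigma i) a c =
  T (j, i) *: \prod_(c <- map_tuple sigma j) a c.
Proof.
move=> /(_ (map_tuple sigma j) i) /(congr1 f); rewrite !linear_sum /=.
rewrite (bigD1 (map_tuple sigma i)) //= big1 => [|h hi]; last first.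
  by rewrite linearZ /= monomial_tensor_power (negPf hi) scaler0.
rewrite (bigD1 j) //= [X in _ = _ + X]big1 => [|h hj]; last first.
  rewrite linearZ /= monomial_tensor_power.
  case: eqP => [/(congr1 val)/= /(inj_map perm_inj)/val_inj e|_].
    by rewrite e eqxx in hj.
  by rewrite scaler0.
by rewrite !addr0 !linearZ /= !monomial_tensor_power !eqxx.
Qed.

End MonomialModel.

(** X^n - 1 splits and is separable, so it has n distinct roots, which suffices for one of them to
    be primitive. *)
Lemma exists_prim_root (C : numClosedFieldType) (n : nat) :
  (0 < n)%N -> exists z : C, n.-primitive_root z.
Proof.
move=> n_gt0; have [r Dp] := closed_field_poly_normal ('X^n - 1 : {poly C}).
rewrite (monicP _) ?monicXnsubC // scale1r in Dp.
have rn1 : all n.-unity_root r by apply/allP=> z; rewrite -root_prod_XsubC -Dp.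
have sz_r : (n < (size r).+1)%N.
  by rewrite -(size_prod_XsubC r id) -Dp size_XnsubC.
have [|z _ ?] := hasP (has_prim_root n_gt0 rn1 _ sz_r); last by exists z.
by rewrite -separable_prod_XsubC -Dp separable_Xn_sub_1 // pnatr_eq0 -lt0n.
Qed.

Lemma parity_count_le (I : finType) q (w : seq I) c : (parity_count q w c <= size w)%N.
Proof.
rewrite /parity_count -[leqRHS]card_ord -sum1_card.
by apply: leq_sum => i _; case: (_ && _).
Qed.

Section LegCounts.
Variables (n k l : nat).
Hypothesis even_kl : ~~ odd (k + l).

(** Labels of upper legs exceed their positions by one, whence [~~ q]; lower legs have labels of the
    parity of their position. *)
Lemma count_legs (i : k.-tuple 'I_n) (j : l.-tuple 'I_n) q c :
  #|[set x | (leg_index i j x == c) && (odd (leg_label x) == q)]| =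
  (parity_count (~~ q) i c + parity_count q j c)%N.
Proof.
rewrite cardsE -sum1_card big_mkcond big_sumType /= /parity_count.
rewrite !size_tuple; congr (_ + _)%N; rewrite big_mkcond /=; apply: eq_bigr => a _.
  rewrite unfold_in /= -tnth_nth andbC.
  by case: (odd a); case: q; case: (_ == c).
rewrite unfold_in /= -tnth_nth andbC.
have -> : odd (k + (l - a)) = odd a.
  by move: even_kl; rewrite !oddD oddB 1?ltnW //; case: (odd k); case: (odd l); case: (odd a).
by case: (_ && _).
Qed.

End LegCounts.

(** * Products of reflections in 2 x 2 matrices *)

Section TwoByTwo.
Variable C : numClosedFieldType.
Implicit Types (x y z w : C) (s : seq C).

Definition antidiag x y : 'M[C]_2 :=
  \matrix_(i, j) if i == j then 0 else if i == 0 then x else y.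
Definition diag2 x y : 'M[C]_2 :=
  \matrix_(i, j) if i != j then 0 else if i == 0 then x else y.

Lemma antidiag_mul x y x' y' : antidiag x y * antidiag x' y' = diag2 (x * y') (y * x').
Proof.
apply/matrixP=> i j; rewrite !mxE !big_ord_recl big_ord0 !mxE /=.
by case: i => [[|[|//]] ?]; case: j => [[|[|//]] ?];
  rewrite /= ?(mul0r, mulr0, addr0, add0r).
Qed.

Lemma antidiag_mul_diag2 x y x' y' :
  antidiag x y * diag2 x' y' = antidiag (x * y') (y * x').
Proof.
apply/matrixP=> i j; rewrite !mxE !big_ord_recl big_ord0 !mxE /=.
by case: i => [[|[|//]] ?]; case: j => [[|[|//]] ?];
  rewrite /= ?(mul0r, mulr0, addr0, add0r).
Qed.

Lemma diag2_1 : diag2 1 1 = 1.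
Proof.
apply/matrixP=> i j; rewrite !mxE.
by case: i => [[|[|//]] ?]; case: j => [[|[|//]] ?].
Qed.

Definition unit_refl z : 'M[C]_2 := antidiag z z^*.

(** This is z1 conj(z2) z3 conj(z4) ..., the nonzero entry in the first row of a product of
    reflections with unimodular parameters. *)
Definition alt_prod s : C := foldr (fun z P => z * P^*) 1 s.

Lemma unit_refl_word s : \prod_(z <- s) unit_refl z =
  if odd (size s) then antidiag (alt_prod s) (alt_prod s)^*
  else diag2 (alt_prod s) (alt_prod s)^*.
Proof.
elim: s => [|z s IHs] /=; first by rewrite big_nil conjC1 diag2_1.
rewrite big_cons IHs /unit_refl if_neg; case: (odd _).
  by rewrite antidiag_mul !rmorphM /= conjCK.
by rewrite antidiag_mul_diag2 !rmorphM /= conjCK.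
Qed.

Lemma unit_refl_sqr z : z * z^* = 1 -> unit_refl z * unit_refl z = 1.
Proof. by move=> z1; rewrite antidiag_mul [_^* * z]mulrC z1 diag2_1. Qed.

Lemma unit_refl_half x y z :
  unit_refl x * unit_refl y * unit_refl z = unit_refl z * unit_refl y * unit_refl x.
Proof.
have E a b c : unit_refl a * unit_refl b * unit_refl c = antidiag (a * b^* * c) (a * b^* * c)^*.
  have := unit_refl_word [:: a; b; c].
  by rewrite !big_cons big_nil mulr1 mulrA => ->; rewrite /= conjC1 mulr1 rmorphM /= conjCK mulrA.
by rewrite !E; have -> : x * y^* * z = z * y^* * x by ring.
Qed.

Fixpoint alt_seq m x y : seq C := if m is m'.+1 then x :: alt_seq m' y x else [::].

Lemma size_alt_seq m x y : size (alt_seq m x y) = m.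
Proof. by elim: m x y => //= m IHm x y; rewrite IHm. Qed.

Lemma alternating_unit_refl m x y :
  alternating m (unit_refl x) (unit_refl y) = \prod_(z <- alt_seq m x y) unit_refl z.
Proof. by elim: m x y => [|m IHm] x y /=; rewrite ?big_nil ?big_cons ?IHm. Qed.

Lemma alt_prod_unit s : all (fun z => z * z^* == 1) s ->
  alt_prod s * (alt_prod s)^* = 1.
Proof.
elim: s => [|z s IHs] /=; first by rewrite mul1r conjC1.
case/andP=> /eqP z1 /IHs s1; rewrite rmorphM /= conjCK mulrACA z1 mul1r.
by rewrite mulrC s1.
Qed.

(** Let P and Q be the alternating products for the two orders. Then P conj(Q) = (x conj(y))^m = 1,
    while Q is unimodular, so P = Q. *)
Lemma unit_refl_mix m x y : x * x^* = 1 -> y * y^* = 1 -> x ^+ m = 1 -> y ^+ m = 1 ->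
  alternating m (unit_refl x) (unit_refl y) = alternating m (unit_refl y) (unit_refl x).
Proof.
move=> x1 y1 xm ym; rewrite !alternating_unit_refl !unit_refl_word !size_alt_seq.
suff -> : alt_prod (alt_seq m x y) = alt_prod (alt_seq m y x) by [].
have E p a b : alt_prod (alt_seq p a b) * (alt_prod (alt_seq p b a))^* = (a * b^*) ^+ p.
  elim: p a b => [|p IHp] a b /=; first by rewrite mul1r conjC1.
  rewrite rmorphM /= conjCK mulrACA [_^* * alt_prod _]mulrC IHp.
  by rewrite exprS; congr (_ * _).
have := E m x y; rewrite exprMn xm mul1r -rmorphXn ym rmorph1.
set P := alt_prod _; set Q := alt_prod _ => PQ.
have QQ : Q * Q^* = 1.
  apply: alt_prod_unit; rewrite /Q; elim: (m) (x) (y) x1 y1 => //= p IHp a b a1 b1.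
  by rewrite b1 eqxx IHp.
by rewrite -[LHS]mulr1 -QQ [Q * _]mulrC mulrA PQ mul1r.
Qed.

Lemma alt_prod_count (I : finType) (z : C) (w : seq I) c : z * z^* = 1 ->
  alt_prod [seq (if a == c then z else 1) | a <- w] =
  z ^+ parity_count false w c * z^* ^+ parity_count true w c.
Proof.
move=> z1; elim: w => [|a w IHw] /=.
  by rewrite /parity_count !big_ord0 mulr1.
rewrite IHw !parity_count_cons /= add0n rmorphM !rmorphXn /= conjCK.
case: (a == c); last by rewrite mul1r mulrC.
by rewrite add1n exprS -mulrA; congr (_ * _); rewrite mulrC.
Qed.

End TwoByTwo.

Lemma unit_refl_star (R : realType) (z : R[i]) : star (unit_refl z) = unit_refl z.
Proof.
apply/matrixP=> i j; rewrite !mxE.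
by case: i => [[|[|//]] ?]; case: j => [[|[|//]] ?]; rewrite /= ?conjC0 ?conjCK.
Qed.

Section Characters.
Variables (R : realType) (A : cstarAlgType R) (f : starHom A 'M[R[i]]_1).

Definition character (x : A) : R[i]^o := f x 0 0.

Fact character_is_zmod_morphism : zmod_morphism character.
Proof. by move=> x y; rewrite /character raddfB !mxE. Qed.

Fact character_is_monoid_morphism : monoid_morphism character.
Proof.
split=> [|x y]; first by rewrite /character rmorph1 mxE.
by rewrite /character rmorphM mxE big_ord1.
Qed.

Fact character_is_scalable : scalable character.
Proof. by move=> c x; rewrite /character linearZ !mxE. Qed.

HB.instance Definition _ :=
  GRing.isZmodMorphism.Build A R[i]^o character character_is_zmod_morphism.
HB.instance Definition _ :=
  GRing.isMonoidMorphism.Build A R[i]^o character character_is_monoid_morphism.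
HB.instance Definition _ :=
  GRing.isScalable.Build R[i] A R[i]^o *:%R character character_is_scalable.

Lemma character_star x : character (star x) = Num.conj (character x).
Proof. by rewrite /character starhom_star !mxE. Qed.

End Characters.

Section UniversalModel.
Variables (R : realType) (n : nat) (s : option nat).
Hypothesis hs : if s is Some m then (1 < m)%N else true.
Variables (A : cstarAlgType R) (u : 'M[A]_n).
Hypothesis univ : forall (B : cstarAlgType R) (v : 'M[B]_n),
  hyperoctahedral_series_rel s v ->
  exists f : starHom A B, forall i j : 'I_n, f (u i j) = v i j.

Lemma permutation_model (sigma : 'S_n) : exists f : starHom A 'M[R[i]]_1,
  forall i j, f (u i j) = monomial sigma (fun=> 1) i j.
Proof.
by apply: univ; apply: monomial_rel => // *; rewrite ?star1 ?mulr1.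
Qed.

Lemma universal_contains_symmetric_group : contains_symmetric_group u.
Proof.
have [f fu] := fin_all_exists permutation_model.
exists (fun sigma => character (f sigma)); split=> [sigma x|sigma i j].
  exact: character_star.
by rewrite /= /character fu mxE; case: (_ == _); rewrite mxE.
Qed.

Variables (k l : nat) (T : tensor_map R n k l).
Hypothesis intT : intertwiner u T.

Lemma intertwiner_perm (sigma : 'S_n) (i : k.-tuple 'I_n) (j : l.-tuple 'I_n) :
  T (map_tuple sigma j, map_tuple sigma i) = T (j, i).
Proof.
have [f fu] := permutation_model sigma.
have := monomial_intertwiner fu i j intT; rewrite !big1_eq.
by move=> /(congr1 (fun x : 'M_1 => x 0 0)); rewrite !mxE !mulr1.
Qed.

Lemma reflection_model (z : 'I_n -> R[i]) : (forall c, z c * (z c)^* = 1) ->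
  (if s is Some m then forall c, z c ^+ m = 1 else True) ->
  exists f : starHom A 'M[R[i]]_2,
    forall i j, f (u i j) = monomial 1%g (fun c => unit_refl (z c)) i j.
Proof.
move=> z1 zm; apply: univ; apply: monomial_rel => //= [c|c|a b c|m sm a b].
- exact: unit_refl_star.
- exact: unit_refl_sqr.
- exact: unit_refl_half.
- by apply: unit_refl_mix; move: zm; rewrite ?sm.
Qed.

Lemma intertwiner_word (i : k.-tuple 'I_n) (j : l.-tuple 'I_n) (z : 'I_n -> R[i]) :
  T (j, i) != 0 -> (forall c, z c * (z c)^* = 1) ->
  (if s is Some m then forall c, z c ^+ m = 1 else True) ->
  \prod_(c <- map z i) unit_refl c = \prod_(c <- map z j) unit_refl c.
Proof.
move=> Tij z1 zm; have [f fu] := reflection_model z1 zm.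
have := monomial_intertwiner fu i j intT.
have map1 p (t : p.-tuple 'I_n) : map_tuple (1%g : 'S_n) t = t.
  by apply: val_inj; rewrite /= (eq_map (@perm1 _)) map_id.
by rewrite !map1 => /(scalerI Tij); rewrite !big_map.
Qed.

Lemma intertwiner_support (i : k.-tuple 'I_n) (j : l.-tuple 'I_n) :
  T (j, i) != 0 ->
  [/\ ~~ odd (k + l) & forall c, #|[set x | (leg_index i j x == c) && odd (leg_label x)]| =
    #|[set x | (leg_index i j x == c) && ~~ odd (leg_label x)]| %[mod odflt 0%N s] ].
Proof.
move=> Tij; have unitw (z : 'I_n -> R[i]) p (t : p.-tuple 'I_n) :
    (forall c, z c * (z c)^* = 1) ->
    alt_prod (map z t) * (alt_prod (map z t))^* = 1.
  by move=> z1; apply: alt_prod_unit; rewrite all_map; apply/allP=> c _; apply/eqP/z1.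
have word_eq (z : 'I_n -> R[i]) : (forall c, z c * (z c)^* = 1) ->
    (if s is Some m then forall c, z c ^+ m = 1 else True) ->
    odd k = odd l /\ alt_prod (map z i) = alt_prod (map z j).
  move=> z1 zm; have := intertwiner_word Tij z1 zm.
  rewrite !unit_refl_word !size_map !size_tuple => E.
  have nz p (t : p.-tuple 'I_n) : alt_prod (map z t) != 0.
    by apply/eqP=> t0; have := unitw z p t z1; rewrite t0 mul0r => /eqP; rewrite eq_sym oner_eq0.
  (* If k and l had different parities, a diagonal matrix with nonzero corner would equal an
     antidiagonal one. *)
  move: (nz _ i) (nz _ j) (congr1 (fun X : 'M_2 => X 0 0) E) (congr1 (fun X : 'M_2 => X 0 1) E).
  case: (odd k) (odd l) => [] []; rewrite !mxE //=.
  - by move=> _ Q0 e; rewrite -e eqxx in Q0.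
  - by move=> P0 _ e; rewrite e eqxx in P0.
have even_kl : ~~ odd (k + l).
  have [] := word_eq (fun=> 1); first by move=> _; rewrite conjC1 mulr1.
    by case: (s) => // m c; rewrite expr1n.
  by rewrite oddD => ->; rewrite addbb.
split=> // c.
(* For s infinite, the order of the root exceeds every count of legs, so that a congruence modulo
   [N] is an equality. *)
pose N := if s is Some m then m else (k + l).+1.
have N0 : (0 < N)%N by rewrite /N; case: (s) hs => // m /ltnW.
have [w wP] := @exists_prim_root R[i] N N0.
have w1 : w * w^* = 1.
  rewrite -normCK; apply/eqP; rewrite sqrp_eq1 // -(pexpr_eq1 N0) //.
  by rewrite -normrX (prim_expr_order wP) normr1.
have [] := word_eq (fun a => if a == c then w else 1).
- by move=> a; case: ifP => _; rewrite ?w1 // conjC1 mulr1.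
- move: wP; rewrite /N; case: (s) => // m wP a.
  by case: ifP => _; rewrite ?expr1n // (prim_expr_order wP).
move=> _; rewrite !alt_prod_count //.
set pi0 := parity_count false i c; set pi1 := parity_count true i c.
set pj0 := parity_count false j c; set pj1 := parity_count true j c => E.
have Ew p : w ^+ p * w^* ^+ p = 1 by rewrite -exprMn w1 expr1n.
(* Conjugates are inverses of unimodular numbers; moving them across [E] leaves an equality of
   powers of the primitive root [w]. *)
have /eqP : w ^+ (pi0 + pj1) = w ^+ (pj0 + pi1).
  rewrite !exprD; have <- : w ^+ pi0 * w^* ^+ pi1 * w ^+ pi1 = w ^+ pi0.
    by rewrite -mulrA [_^* ^+ _ * _]mulrC Ew mulr1.
  rewrite E; set a := w ^+ pi1; rewrite mulrAC; congr (_ * _).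
  by rewrite -mulrA [_^* ^+ _ * _]mulrC Ew mulr1.
rewrite (eq_prim_root_expr wP) => /eqP cong.
have -> : [set x | (leg_index i j x == c) && odd (leg_label x)] =
  [set x | (leg_index i j x == c) && (odd (leg_label x) == true)].
  by apply/setP=> x; rewrite !inE eqb_id.
have -> : [set x | (leg_index i j x == c) && ~~ odd (leg_label x)] =
  [set x | (leg_index i j x == c) && (odd (leg_label x) == false)].
  by apply/setP=> x; rewrite !inE eqbF_neg.
rewrite !count_legs //= -/pi0 -/pi1 -/pj0 -/pj1 [(pi1 + _)%N]addnC.
move: cong; rewrite /N; case: (s) => [m //|] cong.
rewrite /= !modn0; move: cong; rewrite !modn_small // ltnS.
  by rewrite addnC leq_add // -[leqRHS](size_tuple i, size_tuple j) parity_count_le.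
by rewrite leq_add // -[leqRHS](size_tuple i, size_tuple j) parity_count_le.
Qed.

End UniversalModel.

(** * Balanced partitions *)

Section SignedLegCounts.
Variable s : option nat.
Local Notation M := (odflt 0%N s).

Lemma eq_moduloE a b : eq_modulo s a b = (a == b %[mod M]).
Proof. by case: s => //=; rewrite !modn0. Qed.

Definition leg_sign k l (x : leg k l) : int := if odd (leg_label x) then 1 else -1.

Definition signed_count k l (P : pred (leg k l)) : int := \sum_(x | P x) leg_sign x.

(** Divisibility treats finite and infinite s alike, as 0 divides only 0. Arbitrary predicates are
    allowed in order to count fibres and traces of components as well as blocks. *)
Lemma dvd_signed_count k l (P : pred (leg k l)) :
  (M%:Z %| signed_count P)%Z =
  (#|[set x | P x && odd (leg_label x)]| == #|[set x | P x && ~~ odd (leg_label x)]| %[mod M]).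
Proof.
rewrite /signed_count (bigID (fun x => odd (leg_label x))) /=.
rewrite (eq_bigr (fun=> 1)) => [|x /andP[_ ox]]; last by rewrite /leg_sign ox.
rewrite [X in _ + X](eq_bigr (fun=> -1)) => [|x /andP[_ /negPf ox]]; last first.
  by rewrite /leg_sign ox.
rewrite !sumr_const mulNrn !cardsE -eqz_mod_dvd !natz !modz_nat.
by rewrite eqz_nat.
Qed.

Lemma balanced_partsP k l (p : {set {set leg k l}}) :
  reflect [/\ partition p [set: leg k l], ~~ odd (k + l) &
             forall B : {set leg k l}, B \in p -> (M%:Z %| signed_count (mem B))%Z]
          (p \in balanced_parts s k l).
Proof.
rewrite !inE; apply: (iffP and3P) => -[pT ev bal]; split=> //.
  by move=> B Bp; rewrite dvd_signed_count -eq_moduloE; apply: (forall_inP bal).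
by apply/forall_inP=> B Bp; rewrite eq_moduloE -dvd_signed_count bal.
Qed.

(** A predicate constant on blocks describes a union of blocks, and signed counts add up. *)
Lemma dvd_signed_saturated k l (p : {set {set leg k l}}) (P : pred (leg k l)) :
  p \in balanced_parts s k l ->
  (forall B : {set leg k l}, B \in p -> {in B &, forall x y, P x = P y}) ->
  (M%:Z %| signed_count P)%Z.
Proof.
move=> /balanced_partsP[pT _ bal] sat.
have -> : signed_count P = \sum_(x in [set: leg k l] | P x) leg_sign x.
  by apply: eq_bigl => x; rewrite inE.
rewrite (set_partition_big_cond _ pT).
apply: (big_ind (fun z => (M%:Z %| z)%Z)) => [|z t|B Bp]; [exact: dvdz0|exact: rpredD|].
have [x xB] := set0Pn _ (partition_neq0 pT Bp).
have [Px|/negPf Px] := boolP (P x).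
  rewrite (eq_bigl (mem B)); first exact: bal.
  by move=> y; rewrite inE; case: (boolP (y \in B)) => //= yB; rewrite -(sat B Bp x y).
rewrite big_pred0; first exact: dvdz0.
by move=> y; case: (boolP (y \in B)) => //= yB; rewrite -(sat B Bp x y).
Qed.

Lemma balanced_index k l n (p : {set {set leg k l}}) (i : k.-tuple 'I_n) (j : l.-tuple 'I_n) :
  p \in balanced_parts s k l -> delta_part p i j -> forall c,
  #|[set x | (leg_index i j x == c) && odd (leg_label x)]| =
  #|[set x | (leg_index i j x == c) && ~~ odd (leg_label x)]| %[mod M].
Proof.
move=> pD /forall_inP pij c; apply/eqP; rewrite -dvd_signed_count.
apply: (dvd_signed_saturated pD) => B Bp x y xB yB.
by have /forall_inP/(_ x xB)/forall_inP/(_ y yB)/eqP -> := pij B Bp.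
Qed.

Section Kernel.
Variables (n k l : nat) (i : k.-tuple 'I_n) (j : l.-tuple 'I_n).

Definition leg_kernel : {set {set leg k l}} :=
  preim_partition (leg_index i j) [set: leg k l].

Lemma leg_kernelP (B : {set leg k l}) :
  reflect (exists x, B = [set y | leg_index i j x == leg_index i j y]) (B \in leg_kernel).
Proof.
apply: (iffP imsetP) => [[x _ ->]|[x ->]]; exists x => //;
  by apply/setP=> y; rewrite !inE.
Qed.

Lemma delta_leg_kernel (i' : k.-tuple 'I_n) (j' : l.-tuple 'I_n) :
  delta_part leg_kernel i' j' =
  [forall x, forall y, (leg_index i j x == leg_index i j y) ==>
                       (leg_index i' j' x == leg_index i' j' y)].
Proof.
apply/forall_inP/forallP => [h x|h B /leg_kernelP[x ->]].
  apply/forallP=> y; apply/implyP=> xy.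
  have hx : [set y | leg_index i j x == leg_index i j y] \in leg_kernel.
    by apply/leg_kernelP; exists x.
  have /forall_inP/(_ x) := h _ hx; rewrite inE eqxx => /(_ isT)/forall_inP/(_ y).
  by rewrite inE; apply.
apply/forall_inP=> y; rewrite inE => /eqP xy; apply/forall_inP=> z; rewrite inE => /eqP xz.
have /forallP/(_ z)/implyP := h y; apply.
by rewrite -xy -xz.
Qed.

Lemma leg_kernel_balanced : ~~ odd (k + l) ->
  (forall c, #|[set x | (leg_index i j x == c) && odd (leg_label x)]| =
     #|[set x | (leg_index i j x == c) && ~~ odd (leg_label x)]| %[mod M]) ->
  leg_kernel \in balanced_parts s k l.
Proof.
move=> ev bal; apply/balanced_partsP; split=> //; first exact: preim_partitionP.
move=> B /leg_kernelP[x ->]; have /eqP := bal (leg_index i j x).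
rewrite -dvd_signed_count /signed_count => h.
rewrite (eq_bigl (fun y => leg_index i j y == leg_index i j x)) //.
by move=> y; rewrite /= in_set eq_sym.
Qed.

End Kernel.
End SignedLegCounts.

(** * Invariant tensors as combinations of partition maps *)

Lemma perm_extend (X I : finType) (f g : X -> I) :
  (forall x y, (f x == f y) = (g x == g y)) ->
  exists sigma : {perm I}, forall x, sigma (f x) = g x.
Proof.
move=> fg.
have [h hP] : exists h : I -> I, forall x, h (f x) = g x.
  exists (fun a => if [pick x | f x == a] is Some x then g x else a) => x.
  by case: pickP => [y|/(_ x)]; rewrite ?eqxx // fg => /eqP.
pose A := [set f x | x in X]; pose A' := [set g x | x in X].
have h_inj : {in A &, injective h}.
  move=> _ _ /imsetP[x _ ->] /imsetP[y _ ->]; rewrite !hP => /eqP.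
  by rewrite -fg => /eqP.
have hA : h @: A = A'.
  by rewrite -imset_comp; apply: eq_imset => x; rewrite /= hP.
have cA : #|~: A| = #|~: A'|.
  by rewrite [LHS]cardsCs [RHS]cardsCs !setCK -hA card_in_imset.
(* On the image [A] of [f] the map is [h]; the complements of [A] and [A'] have equal size and are
   matched through their enumerations. *)
pose sig a := if a \in A then h a else nth a (enum (~: A')) (index a (enum (~: A))).
have sigA a : (sig a \in A') = (a \in A).
  rewrite /sig; case: ifP => aA; first by rewrite -hA imset_f.
  apply/negbTE; rewrite -in_setC -mem_enum mem_nth // -cardE -cA cardE index_mem.
  by rewrite mem_enum inE aA.
have sig_inj : injective sig.
  move=> a b ab; have := sigA a; rewrite ab sigA => E.
  have [aA|aA] := boolP (a \in A).
    by apply: h_inj; rewrite ?E //; move: ab; rewrite /sig E aA.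
  have idx c : c \notin A -> (index c (enum (~: A)) < size (enum (~: A')))%N.
    by move=> cA'; rewrite -cardE -cA cardE index_mem mem_enum inE.
  have bA : b \notin A by rewrite E.
  move: ab; rewrite /sig E (negPf aA) (set_nth_default b) ?idx // => /eqP.
  rewrite nth_uniq ?enum_uniq ?idx // => /eqP ab.
  have aE : a \in enum (~: A) by rewrite mem_enum inE.
  have bE : b \in enum (~: A) by rewrite mem_enum inE.
  by rewrite -(nth_index a aE) ab nth_index.
exists (perm sig_inj) => x; rewrite permE /sig hP imset_f //.
Qed.

Section KernelSpan.
Variables (R : realType) (n : nat) (s : option nat) (k l : nat).
Local Notation bal_span := (<<[seq part_map R n p | p <- enum (balanced_parts s k l)]>>%VS).

(** The kernel as a set of pairs, so that coarsening is inclusion of sets. *)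
Definition kernel_rel (i : k.-tuple 'I_n) (j : l.-tuple 'I_n) : {set leg k l * leg k l} :=
  [set xy | leg_index i j xy.1 == leg_index i j xy.2].

Lemma delta_kernel_rel (i i' : k.-tuple 'I_n) (j j' : l.-tuple 'I_n) :
  delta_part (leg_kernel i j) i' j' = (kernel_rel i j \subset kernel_rel i' j').
Proof.
rewrite delta_leg_kernel; apply/forallP/subsetP => [h [x y]|h x].
  by rewrite !inE /=; have /forallP/(_ y)/implyP := h x.
by apply/forallP=> y; apply/implyP=> xy; have := h (x, y); rewrite !inE /=; apply.
Qed.

Definition kernel_indicator (S : {set leg k l * leg k l}) : tensor_map R n k l :=
  [ffun ji => (kernel_rel ji.2 ji.1 == S)%:R].

(** Moebius inversion by induction on the number of pairs outside [S]: T_p for the kernel p is the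
    sum of the indicators of all relations containing [S], and the strictly larger ones are in the
    span already. They inherit balancedness because their blocks are unions of blocks of p. *)
Lemma kernel_indicator_span (S : {set leg k l * leg k l}) :
  (forall i j, kernel_rel i j = S -> leg_kernel i j \in balanced_parts s k l) ->
  kernel_indicator S \in bal_span.
Proof.
have [m mS] := ubnP (#|[set: leg k l * leg k l]| - #|S|).
elim: m S mS => // m IHm S mS bal.
case: (pickP (fun ji : (l.-tuple 'I_n) * (k.-tuple 'I_n) => kernel_rel ji.2 ji.1 == S)) =>
    [[j i] /= /eqP ijS|noS]; last first.
  suff -> : kernel_indicator S = 0 by apply: mem0v.
  by apply/ffunP=> ji; rewrite !ffunE noS.
have pD := bal _ _ ijS; set p := leg_kernel i j in pD.
have E : part_map R n p = \sum_(S' : {set leg k l * leg k l} | S \subset S') kernel_indicator S'.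
  apply/ffunP=> -[j' i']; rewrite !ffunE sum_ffunE /= delta_kernel_rel ijS.
  have [sub|nsub] := boolP (S \subset _).
    rewrite (bigD1 (kernel_rel i' j')) //= ffunE eqxx big1 ?addr0 // => S' /andP[_ ne].
    by rewrite ffunE eq_sym (negPf ne).
  rewrite big1 // => S' sub; rewrite ffunE /=; case: eqP => // e.
  by rewrite e sub in nsub.
have -> : kernel_indicator S = part_map R n p -
    \sum_(S' : {set leg k l * leg k l} | S \proper S') kernel_indicator S'.
  rewrite E (bigD1 S) //= -[LHS]addr0 -addrA; congr (_ + _).
  rewrite [X in X - _](_ : _ =
    \sum_(S' : {set leg k l * leg k l} | S \proper S') kernel_indicator S') ?subrr //.
  by apply: eq_bigl => S'; rewrite properEneq andbC eq_sym.
apply: rpredB.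
  by apply: memv_span; apply: map_f; rewrite mem_enum.
apply: rpred_sum => S' SS'; apply: IHm.
  have := proper_card SS'; have := subset_leq_card (subsetT S'); lia.
move=> i' j' e; have pij' : delta_part p i' j'.
  by rewrite delta_kernel_rel ijS e proper_sub.
apply: leg_kernel_balanced; first by case/balanced_partsP: pD.
exact: balanced_index pD pij'.
Qed.

Lemma invariant_span (T : tensor_map R n k l) :
  (forall (sigma : 'S_n) i j, T (map_tuple sigma j, map_tuple sigma i) = T (j, i)) ->
  (forall i j, T (j, i) != 0 -> leg_kernel i j \in balanced_parts s k l) ->
  T \in bal_span.
Proof.
move=> inv supp.
(* Indices with the same kernel lie in one orbit of the symmetric group. *)
have Tker i j i' j' : kernel_rel i j = kernel_rel i' j' -> T (j, i) = T (j', i').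
  move=> e; have [sigma sP] : exists sigma : 'S_n, forall x,
      sigma (leg_index i j x) = leg_index i' j' x.
    apply: perm_extend => x y.
    by have := congr1 (fun S : {set _} => (x, y) \in S) e; rewrite !inE.
  rewrite -(inv sigma); congr (T (_, _)); apply: eq_from_tnth => a; rewrite tnth_map.
    exact: (sP (inr a)).
  exact: (sP (inl a)).
(* The common value of [T] on the indices with kernel [S]; the default 0 is for relations that are
   no kernel. *)
pose c (S : {set leg k l * leg k l}) : R[i] :=
  if [pick ji | kernel_rel ji.2 ji.1 == S] is Some ji then T ji else 0.
have cE i j : c (kernel_rel i j) = T (j, i).
  by rewrite /c; case: pickP => [[j' i'] /eqP/Tker|/(_ (j, i))] //=; rewrite eqxx.
have -> : T = \sum_S c S *: kernel_indicator S.
  apply/ffunP=> -[j i]; rewrite sum_ffunE (bigD1 (kernel_rel i j)) //= !ffunE eqxx.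
  rewrite cE [_ *: _]mulr1 big1 ?addr0 // => S ne.
  by rewrite !ffunE eq_sym (negPf ne) [_ *: _]mulr0.
apply: rpred_sum => S _; have [->|cS] := eqVneq (c S) 0.
  by rewrite scale0r mem0v.
apply: rpredZ; apply: kernel_indicator_span => i j ijS; apply: supp.
by rewrite -cE ijS.
Qed.

End KernelSpan.

(** * Stability of balanced partitions under the category operations *)

Lemma partitionU (T : finType) (P Q : {set {set T}}) (D E : {set T}) :
  [disjoint D & E] -> partition P D -> partition Q E -> partition (P :|: Q) (D :|: E).
Proof.
move=> DE /and3P[/eqP cP tP P0] /and3P[/eqP cQ tQ Q0]; apply/and3P; split.
- by rewrite /cover bigcup_setU -/(cover P) -/(cover Q) cP cQ.
- by apply: trivIsetU; rewrite ?cP ?cQ.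
- by rewrite inE negb_or P0.
Qed.

Section BalancedCategory.
Variable s : option nat.
Local Notation M := (odflt 0%N s).

Lemma signed_count_imset k l k' l' (h : leg k l -> leg k' l') (B : {set leg k l}) :
  injective h ->
  signed_count (mem (h @: B)) = \sum_(x in B) leg_sign (h x).
Proof. by move=> h_inj; rewrite /signed_count big_imset // => x y _ _ /h_inj. Qed.

(** The upper leg at the same position a has label a + 1, so legs at equal positions of opposite
    rows have opposite signs. *)
Lemma odd_label_inr k l (b : 'I_l) : ~~ odd (k + l) ->
  odd (leg_label (inr b : leg k l)) = odd b.
Proof.
rewrite /= !oddD oddB 1?ltnW //.
by case: (odd k); case: (odd l); case: (odd b).
Qed.

Lemma balanced_turn k l (p : {set {set leg k l}}) :
  p \in balanced_parts s k l -> part_turn p \in balanced_parts s l k.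
Proof.
move=> /balanced_partsP[pT ev bal]; rewrite /part_turn.
set h := (fun x : leg k l => _).
have h_inj : injective h by move=> [a|a] [b|b] //= [->].
have evt : ~~ odd (l + k) by rewrite addnC.
apply/balanced_partsP; split=> //.
  have <- : h @: [set: leg k l] = [set: leg l k].
    apply/setP=> x; rewrite inE; apply/imsetP.
    by case: x => a; [exists (inr a)|exists (inl a)].
  by rewrite imset_partition.
move=> _ /imsetP[B Bp ->]; rewrite signed_count_imset //.
rewrite (eq_bigr (fun x => - leg_sign x)); first by rewrite sumrN rpredN; apply: bal.
move=> [a|b] _; rewrite /leg_sign.
  by rewrite odd_label_inr //=; case: (odd a).
by rewrite odd_label_inr //=; case: (odd b).
Qed.

Lemma balanced_hcat k1 l1 k2 l2 (p : {set {set leg k1 l1}}) (q : {set {set leg k2 l2}}) :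
  p \in balanced_parts s k1 l1 -> q \in balanced_parts s k2 l2 ->
  part_hcat p q \in balanced_parts s (k1 + k2) (l1 + l2).
Proof.
move=> /balanced_partsP[pT ev1 bal1] /balanced_partsP[qT ev2 bal2]; rewrite /part_hcat.
set f := (fun x : leg k1 l1 => _); set g := (fun x : leg k2 l2 => _).
have f_inj : injective f.
  by move=> [a|a] [b|b] //= [] => [/eqP|/eqP] ab; congr (_ _); apply: val_inj; apply/eqP.
have g_inj : injective g.
  by move=> [a|a] [b|b] //= [] => [/eqP|/eqP]; rewrite eqn_add2l => ab;
    congr (_ _); apply: val_inj; apply/eqP.
have ev : ~~ odd (k1 + k2 + (l1 + l2)) by rewrite addnACA oddD (negPf ev1) (negPf ev2).
apply/balanced_partsP; split=> //.
  have <- : f @: [set: leg k1 l1] :|: g @: [set: leg k2 l2] = [set: leg (k1 + k2) (l1 + l2)].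
    apply/setP=> x; rewrite !inE; apply/orP; case: x => a.
      case: (split_ordP a) => b ->; [left|right]; apply/imsetP.
        by exists (inl b).
      by exists (inl b).
    case: (split_ordP a) => b ->; [left|right]; apply/imsetP.
      by exists (inr b).
    by exists (inr b).
  apply: partitionU; rewrite ?imset_partition //.
  apply/pred0P=> x /=; apply/negbTE/negP => /andP[/imsetP[y _ ->] /imsetP[z _]].
  by case: y z => [a|a] [b|b] //= [] e;
    have := ltn_ord a; rewrite e ltnNge leq_addr.
move=> B; rewrite inE => /orP[] /imsetP[C Cp ->]; rewrite signed_count_imset //.
  rewrite (eq_bigr (@leg_sign _ _)); first exact: bal1.
  by move=> [a|b] _; rewrite /leg_sign ?odd_label_inr.
(* As k1 + l1 is even, both rows of [q] are shifted by numbers of the same parity: its legs all keep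
   their sign or all change it. *)
have [k1e|k1o] := boolP (odd k1); last first.
  rewrite (eq_bigr (@leg_sign _ _)); first exact: bal2.
  have l1e : odd l1 = false by move: ev1; rewrite oddD (negPf k1o) => /negPf.
  move=> [a|b] _; rewrite /leg_sign ?odd_label_inr //=.
    by rewrite oddD (negPf k1o).
  by rewrite oddD l1e.
rewrite (eq_bigr (fun x => - leg_sign x)); first by rewrite sumrN rpredN; apply: bal2.
have l1o : odd l1 by move: ev1; rewrite oddD k1e negbK.
move=> [a|b] _; rewrite /leg_sign ?odd_label_inr //=.
  by rewrite oddD k1e; case: (odd a).
by rewrite oddD l1o; case: (odd b).
Qed.

Section VerticalConcatenation.
Variables (k l m : nat) (p : {set {set leg k l}}) (q : {set {set leg l m}}).
Local Notation point := ('I_k + 'I_l + 'I_m)%type.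

(** These definitions restate the local ones of [part_vcat], so that [part_vcatE] holds by
    computation. *)
Definition top_point (x : leg k l) : point := inl x.
Definition bottom_point (x : leg l m) : point :=
  match x with inl a => inl (inr a) | inr b => inr b end.
Definition outer_point (x : leg k m) : point :=
  match x with inl a => inl (inl a) | inr b => inr b end.

Definition stacked : rel point := fun x y =>
  [exists B in p, (x \in top_point @: (B : {set _})) && (y \in top_point @: (B : {set _}))]
  || [exists B in q,
       (x \in bottom_point @: (B : {set _})) && (y \in bottom_point @: (B : {set _}))].

Lemma part_vcatE : part_vcat p q =
  equivalence_partition (fun x y => connect stacked (outer_point x) (outer_point y))
    [set: leg k m].
Proof. by []. Qed.

Lemma stacked_sym : connect_sym stacked.
Proof.
apply: sym_connect_sym => x y; rewrite /stacked.
by congr (_ || _); apply: eq_existsb => B; rewrite [X in _ && X]andbC.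
Qed.

Hypotheses (pD : p \in balanced_parts s k l) (qD : q \in balanced_parts s l m).

(** A connected component meets each of the two diagrams in a union of blocks, so both signed counts
    are divisible. In their sum every middle point occurs once as a lower leg of [p] and once as an
    upper leg of [q], with opposite signs. *)
Lemma balanced_vcat : part_vcat p q \in balanced_parts s k m.
Proof.
have [pT ev1 _] := balanced_partsP _ _ pD; have [qT ev2 _] := balanced_partsP _ _ qD.
have ev : ~~ odd (k + m).
  by move: ev1 ev2; rewrite !oddD; case: (odd k); case: (odd l); case: (odd m).
apply/balanced_partsP; rewrite part_vcatE; split=> //.
  apply: equivalence_partitionP => x y z _ _ _; split; first exact: connect0.
  by move=> xy; apply: same_connect => //; exact: stacked_sym.
move=> _ /imsetP[x0 _ ->]; pose P := connect stacked (outer_point x0).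
have Pp : (M%:Z %| signed_count (fun x => P (top_point x)))%Z.
  apply: (dvd_signed_saturated pD) => B Bp x y xB yB.
  apply: same_connect1r; first exact: stacked_sym.
  apply/orP; left; apply/existsP; exists B; rewrite Bp /=.
  by rewrite !imset_f.
have Pq : (M%:Z %| signed_count (fun x => P (bottom_point x)))%Z.
  apply: (dvd_signed_saturated qD) => B Bq x y xB yB.
  apply: same_connect1r; first exact: stacked_sym.
  apply/orP; right; apply/existsP; exists B; rewrite Bq /=.
  by rewrite !imset_f.
suff -> : signed_count (mem [set y in [set: leg k m] |
      connect stacked (outer_point x0) (outer_point y)]) =
    signed_count (fun x => P (top_point x)) + signed_count (fun x => P (bottom_point x)).
  exact: rpredD.
rewrite /signed_count (eq_bigl (fun y => P (outer_point y))); last first.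
  by move=> y; rewrite !inE.
rewrite !big_sumType /= -addrA; congr (_ + _).
rewrite addrA -big_split /= [X in _ = X + _]big1 ?add0r => [|b _].
  by apply: eq_bigr => b _; rewrite /leg_sign !odd_label_inr.
by rewrite /leg_sign odd_label_inr //=; case: (odd b).
Qed.

End VerticalConcatenation.

Lemma partition_setT (T : finType) : (0 < #|T|)%N -> partition [set [set: T]] [set: T].
Proof.
move=> T0; apply/and3P; split; rewrite ?cover1 ?trivIset1 //.
by rewrite inE eq_sym -cards_eq0 cardsT -lt0n.
Qed.

Lemma balanced_category : partition_category (balanced_parts s).
Proof.
split.
- by move=> k l; apply/subsetP=> p; rewrite inE => /and3P[].
- exact: balanced_hcat.
- exact: balanced_vcat.
- exact: balanced_turn.
split; apply/balanced_partsP; split=> //.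
- by apply: partition_setT; rewrite card_sum !card_ord.
- move=> B /set1P->; rewrite /signed_count (eq_bigl xpredT) => [|x]; last by rewrite !inE.
  by rewrite big_sumType /= !big_ord_recl !big_ord0 /leg_sign /=.
- by apply: partition_setT; rewrite card_sum !card_ord.
- move=> B /set1P->; rewrite /signed_count (eq_bigl xpredT) => [|x]; last by rewrite !inE.
  by rewrite big_sumType /= !big_ord_recl !big_ord0 /leg_sign /=.
Qed.

End BalancedCategory.

(** * Linear combinations of intertwiners, and easiness *)

Lemma intertwiner_linear (R : realType) (n : nat) (A : cstarAlgType R) (u : 'M[A]_n)
    (k l : nat) (I : finType) (c : I -> R[i]) (T : I -> tensor_map R n k l) :
  (forall x, intertwiner u (T x)) -> intertwiner u (\sum_x c x *: T x).
Proof.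
move=> intT j i.
have E (p : l.-tuple 'I_n) (q : k.-tuple 'I_n) a :
    (\sum_x c x *: T x) (p, q) *: a = \sum_x c x *: (T x (p, q) *: a) :> A.
  by rewrite sum_ffunE scaler_suml; apply: eq_bigr => x _; rewrite ffunE scalerA.
under eq_bigr do rewrite E; rewrite exchange_big /=.
under [RHS]eq_bigr do rewrite E; rewrite [RHS]exchange_big /=.
by apply: eq_bigr => x _; rewrite -!scaler_sumr intT.
Qed.

Theorem theorem3p3 (R : realType) (n : nat) (s : option nat)
    (hs : if s is Some m then (1 < m)%N else true)
    (A : cstarAlgType R) (u : 'M[A]_n)
    (hA : universal_cstar (@hyperoctahedral_series_rel R n s) u) :
  easy_quantum_group u (balanced_parts s).
Proof.
have [hu gen univ] := hA; have [ou _ _ _] := hu; have [u_star uuT uTu] := ou.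
split.
- split=> //; first by exists u^T.
    exists u^T; suff -> : map_mx star u = u by [].
    by apply/matrixP=> i j; rewrite mxE u_star.
  move=> T f g [[fg _ _] _].
  have [Delta DeltaE] := univ _ _ (comultiplication_rel hs hu fg).
  by exists Delta => i j; rewrite DeltaE mxE.
- exact (universal_contains_symmetric_group hs univ).
- by split=> // B v [_ _]; apply.
- exact: balanced_category.
(* For the converse, [coord_span] expands [T] in the generators, and each generator is an
   intertwiner. *)
move=> k l T; split=> [intT|/coord_span ->].
  apply: invariant_span => [sigma i j|i j Tij].
    exact (intertwiner_perm hs univ intT sigma i j).
  have [even_kl bal] := intertwiner_support hs univ intT Tij.
  exact: leg_kernel_balanced.
apply: (@intertwiner_linear _ _ _ _ _ _ _ (fun x => coord _ x T) (fun x => _`_x)) => x.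
rewrite (nth_map set0) ?size_tuple //; set p := nth _ _ _.
have pD : p \in balanced_parts s k l.
  by rewrite -mem_enum; apply: mem_nth; rewrite -cardE.
apply: (part_map_intertwiner hs hu); first by case/balanced_partsP: pD.
by move=> i j; apply: balanced_index.
Qed.
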